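(* Let $I\subset S=k[x_0,\dots,x_r]$ be an ideal generated by quadratic monomials, written as $I=I_\Delta+I_s$, where $I_\Delta$ is the Stanley–Reisner ideal generated by the squarefree quadratic monomials in $I$, for a simplicial complex $\Delta$ with vertices $x_0,\dots,x_r$, and $I_s$ is generated by $\{x_i^2 \mid x_i^2\in I\}$. Call a vertex $x$ of $\Delta$ a square vertex for $I$ if $x^2\in I$. (a) The ideal $I$ satisfies $\mathbf{N}_{2,2}$ if and only if $I_\Delta$ satisfies $\mathbf{N}_{2,2}$ and, for every square vertex $x$ for $I$, $\operatorname{link}(x,\Delta)$ is a simplex not containing any square vertex for $I$. (b) If $I$ satisfies $\mathbf{N}_{2,2}$, then, for $p\ge 3$, $I$ satisfies $\mathbf{N}_{2,p}$ if and only if $I_\Delta$ satisfies $\mathbf{N}_{2,p}$.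
   Context: $k$ is an algebraically closed field. For a simplicial complex $\Delta$ on the vertices $x_0,\dots,x_r$, $I_\Delta$ is generated by the squarefree monomials $x_{i_1}\cdots x_{i_s}$ such that $\{x_{i_1},\dots,x_{i_s}\}$ is not a face of $\Delta$. The link $\operatorname{link}(x,\Delta)$ is the complex of faces $F\in\Delta$ with $x\notin F$ and $F\cup\{x\}\in\Delta$; a simplex is the complex of all subsets of a finite vertex set, the empty vertex set being allowed. A homogeneous ideal $I\subset S$ containing no nonzero forms of degree $\le 1$ satisfies $\mathbf{N}_{2,p}$ ($p\ge1$) if $\operatorname{Tor}_i^S(I,k)$ is concentrated in degrees $\le i+2$ for all $0\le i\le p-1$ (i.e. $I$ is generated by quadrics and its minimal free resolution is linear for the first $p$ steps). *)

(* Defs.v *)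
From mathcomp Require Export all_boot all_order all_algebra.
From mathcomp.multinomials Require Export mpoly.

Set Implicit Arguments.
Unset Strict Implicit.
Unset Printing Implicit Defensive.

Import GRing.Theory.
Local Open Scope ring_scope.

(* Ideals of S = k[x_0, ..., x_(n-1)] are Prop-valued subsets of S, and
   equality of ideals is pointwise equivalence. *)

Section Ideals.
Variables (k : fieldType) (n : nat).
Local Notation S := {mpoly k[n]}.
Implicit Types I J G : S -> Prop.

Definition same_ideal I J : Prop := forall f, I f <-> J f.

Definition ideal_gen G : S -> Prop := fun f =>
  exists2 s : seq (S * S),
    (forall p, p \in s -> G p.2) & f = \sum_(p <- s) p.1 * p.2.

Definition ideal_add I J : S -> Prop := fun f =>
  exists g h, [/\ I g, J h & f = g + h].

Definition homogeneous_ideal I : Prop :=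
  exists2 G : S -> Prop,
    (forall g, G g -> exists d : nat, g \is d.-homog) &
    same_ideal I (ideal_gen G).

Definition gen_by_quadratic_monomials I : Prop :=
  exists2 M : 'X_{1..n} -> Prop,
    (forall m, M m -> mdeg m = 2) &
    same_ideal I (ideal_gen (fun f => exists2 m, M m & f = 'X_[m])).

Definition squarefree_part I : S -> Prop :=
  ideal_gen (fun f => exists i j : 'I_n, [/\ i != j, f = 'X_i * 'X_j & I f]).

Definition square_part I : S -> Prop :=
  ideal_gen (fun f => exists2 i : 'I_n, f = 'X_i ^+ 2 & I f).

Definition square_vertex I (x : 'I_n) : Prop := I ('X_x ^+ 2).

(* A resolution ... -> F_1 -> F_0 -> I -> 0 by graded free modules of finite
   rank, F_i = \bigoplus_a S(- gdeg i a).  Elements of F_i are row vectors and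
   maps act by right multiplication; a matrix entry from a generator of degree
   d to one of degree e is a form of degree d - e, hence zero if d < e. *)
Record graded_free_resolution I := GradedFreeResolution {
  rk : nat -> nat;
  gdeg : forall i, 'I_(rk i) -> nat;
  aug : 'cV[S]_(rk 0);
  diff : forall i, 'M[S]_(rk i.+1, rk i);
  aug_homog : forall a, aug a ord0 \is (gdeg a).-homog;
  diff_homog : forall i (a : 'I_(rk i.+1)) (b : 'I_(rk i)),
    if (gdeg b <= gdeg a)%N then diff i a b \is (gdeg a - gdeg b).-homog
    else diff i a b == 0;
  aug_image : forall f, I f <-> exists v : 'rV[S]_(rk 0), v *m aug = f%:M;
  exact_aug : forall v : 'rV[S]_(rk 0),
    v *m aug = 0 <-> exists w : 'rV[S]_(rk 1), v = w *m diff 0;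
  exact_diff : forall i (v : 'rV[S]_(rk i.+1)),
    v *m diff i = 0 <-> exists w : 'rV[S]_(rk i.+2), v = w *m diff i.+1
}.

Section Tor.
Variables (I : S -> Prop) (F : graded_free_resolution I).

(* Over k = S / (x_0, ..., x_(n-1)), a matrix is reduced to its constant
   terms, and F_i (x) k has k-basis the generators of F_i, with their degrees. *)
Definition diffk i : 'M[k]_(rk F i.+1, rk F i) := map_mx (mcoeff 0%MM) (diff F i).

Definition in_degree i j (v : 'rV[k]_(rk F i)) : Prop :=
  forall a, v ord0 a != 0 -> gdeg a = j.

Definition cyclek i : 'rV[k]_(rk F i) -> Prop :=
  match i with
  | 0 => fun _ => True
  | i'.+1 => fun v => v *m diffk i' = 0
  end.

Definition homologyk_eq0 i j : Prop :=
  forall v : 'rV[k]_(rk F i), in_degree j v -> cyclek v ->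
  exists2 w : 'rV[k]_(rk F i.+1), in_degree j w & v = w *m diffk i.

End Tor.

(* Tor_i^S(I, k)_j = 0.  The homology does not depend on the resolution. *)
Definition Tor_eq0 I i j : Prop :=
  exists F : graded_free_resolution I, homologyk_eq0 F i j.

Definition N2 I (p : nat) : Prop :=
  [/\ homogeneous_ideal I,
      (forall (f : S) (d : nat), (d <= 1)%N -> f \is d.-homog -> I f -> f = 0) &
      forall i, (i < p)%N -> forall j, (i + 2 < j)%N -> Tor_eq0 I i j].

End Ideals.

Section Complexes.
Variable n : nat.
Implicit Types D : {set {set 'I_n}}.

(* Every x_i is a vertex, i.e. [set i] is a face. *)
Definition simplicial_complex D : Prop :=
  (forall A B : {set 'I_n}, A \subset B -> B \in D -> A \in D) /\
  (forall i : 'I_n, [set i] \in D).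

Definition link (x : 'I_n) D : {set {set 'I_n}} :=
  [set A in D | (x \notin A) && (x |: A \in D)].

Definition is_simplex D : Prop := exists V : {set 'I_n}, D = powerset V.

Definition stanley_reisner (k : fieldType) D : {mpoly k[n]} -> Prop :=
  ideal_gen (fun f => exists2 A : {set 'I_n}, A \notin D & f = \prod_(i in A) 'X_i).

End Complexes.
Arguments stanley_reisner {n} k D.

(* Main.v *)
Require Import Defs.
From mathcomp Require Import zify.
From Stdlib Require Import Classical.

(* Tor_l(I, k) is computed by tensoring I with the Koszul complex.  For a
   monomial ideal this splits over multidegrees b, and the part of degree b is the
   reduced homology, in dimension l - 1, of the upper Koszul complex
   K^b(I) = { A | x^b / x^A in I }.

   If b is squarefree then K^b(I) = K^b(I_Delta), and otherwise K^b(I_Delta) is a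
   cone; so vanishing for I implies vanishing for I_Delta.  For the converse,
   suppose that for every square vertex x the link of x is a simplex without
   square vertices, i.e. yz in I implies xy in I or xz in I.  Then the monomials
   of I outside I_Delta form a direct sum of copies of quotients
   x^2 S / (linear forms), whose Koszul homology is linear: off the linear strand,
   any cycle on K^b(I) relative to K^b(I_Delta) can be coned off.  Finally the
   condition on links is forced by Tor_1(I, k) in the degrees x^2 y z, where a
   violation disconnects K^b(I). *)

Set Implicit Arguments.
Unset Strict Implicit.
Unset Printing Implicit Defensive.

Import GRing.Theory.
Local Open Scope ring_scope.

(** * Koszul differentials *)

Section KoszulDifferential.
Variables (n : nat) (R : comNzRingType).
Implicit Types (A B : {set 'I_n}) (i j t : 'I_n).

Definition ksgn i A : R := (-1) ^+ #|[set a in A | (a < i)%N]|.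

Lemma ksgnU i j A :
  i \notin A -> ksgn j (i |: A) = (if (i < j)%N then - ksgn j A else ksgn j A).
Proof.
move=> iA; rewrite /ksgn; case: ltnP => ij.
  rewrite (_ : [set a in i |: A | _] = i |: [set a in A | (a < j)%N]).
    by rewrite cardsU1 !inE (negbTE iA) /= exprS mulN1r.
  by apply/setP=> a; rewrite !inE; case: eqP => [->|].
congr (_ ^+ _); apply: eq_card => a; rewrite !inE; case: eqP => [->|//].
by rewrite ltnNge ij (negbTE iA).
Qed.

Lemma ksgn_swap i j A : i \notin A -> j \notin A -> i != j ->
  ksgn i A * ksgn j (i |: A) = - (ksgn j A * ksgn i (j |: A)).
Proof.
move=> iA jA ij; rewrite !ksgnU //.
case: (ltngtP i j) => [||/val_inj e]; last by rewrite e eqxx in ij.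
  by rewrite mulrN mulrC.
by rewrite mulrN opprK mulrC.
Qed.

Lemma ksgn_sqr i A : ksgn i A * ksgn i A = 1.
Proof. by rewrite /ksgn -exprD addnn -mul2n exprM sqrrN !expr1n. Qed.

Lemma ksgn0 i : ksgn i set0 = 1.
Proof. by rewrite /ksgn eq_card0 ?expr0 // => a; rewrite !inE. Qed.

Section Differential.
Variables (V : lmodType R) (x : 'I_n -> R).
Implicit Type c : {set 'I_n} -> V.

(** A chain is stored as its coefficient function on subsets, so the boundary at [A] collects the
    sets [i |: A]. Variables as weights [x] give the Koszul differential, weights 1 the simplicial
    one. *)
Definition kdiff c A : V :=
  \sum_(i | i \notin A) (ksgn i A * x i) *: c (i |: A).

Lemma eq_kdiff c c' : c =1 c' -> kdiff c =1 kdiff c'.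
Proof. by move=> e A; apply: eq_bigr => i _; rewrite e. Qed.

Lemma kdiffB c c' A : kdiff (fun B => c B - c' B) A = kdiff c A - kdiff c' A.
Proof.
by rewrite /kdiff -sumrB; apply: eq_bigr => i _; rewrite scalerBr.
Qed.

Lemma kdiff0 A : kdiff (fun=> 0) A = 0.
Proof. by rewrite /kdiff big1 // => i _; rewrite scaler0. Qed.

Lemma kdiff_kdiff c A : kdiff (kdiff c) A = 0.
Proof.
pose G i j := (ksgn i A * x i) *: ((ksgn j (i |: A) * x j) *: c (j |: (i |: A))).
have GN i j : i \notin A -> j \notin A -> i != j -> G i j = - G j i.
  move=> iA jA ij; rewrite /G !scalerA setUCA -scaleNr; congr (_ *: _).
  by rewrite mulrACA (ksgn_swap iA jA ij) [x i * _]mulrC mulNr mulrACA.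
(* The double sum is split by the order of [i] and [j]; exchanging the summations in one half pairs
   each [G i j] with its negative [G j i]. *)
have -> : kdiff (kdiff c) A =
    \sum_(i | i \notin A) (\sum_(j | (j \notin A) && (i < j)%N) G i j
       + \sum_(j | (j \notin A) && (j < i)%N) G i j).
  apply: eq_bigr => i iA; rewrite scaler_sumr.
  rewrite (bigID (fun j : 'I_n => (i < j)%N)) /=; congr (_ + _); apply: eq_bigl => j.
    rewrite in_setU1 negb_or; case: eqP => [->|] //=.
    by rewrite ltnn andbF.
  rewrite in_setU1 negb_or -leqNgt leq_eqVlt.
  have -> : (val j == val i) = (j == i) by [].
  by case: eqP => [->|] //=; rewrite ltnn andbF.
rewrite big_split /= addrC.
rewrite [X in X + _](exchange_big_dep (fun j => j \notin A)) /=; last by move=> i j _ /andP[].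
rewrite -big_split big1 //= => i iA.
rewrite (eq_bigl (fun j => (j \notin A) && (i < j)%N)); last first.
  by move=> j; rewrite iA.
rewrite -big_split big1 //= => j /andP[jA ij].
have ne : j != i by apply: contraTneq ij => ->; rewrite ltnn.
by rewrite (GN j i) // addNr.
Qed.

End Differential.

(* The contracting homotopy of the full simplex given by coning from t. *)
Definition kcone (V : lmodType R) t (c : {set 'I_n} -> V) A : V :=
  if t \in A then ksgn t (A :\ t) *: c (A :\ t) else 0.

Lemma kcone_homotopy (V : lmodType R) t (c : {set 'I_n} -> V) A :
  kdiff (fun=> 1) (kcone t c) A + kcone t (kdiff (fun=> 1) c) A = c A.
Proof.
rewrite /kcone; case: (boolP (t \in A)) => tA; last first.
  rewrite addr0 /kdiff (bigD1 t) //= setU11 setU1K // mulr1 scalerA.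
  rewrite ksgn_sqr scale1r big1 ?addr0 // => i /andP[iA it].
  by rewrite in_setU1 eq_sym (negbTE it) (negbTE tA) scaler0.
have tB : t \notin A :\ t by rewrite setD11.
(* The term [t] of the inner boundary gives back [c A]; every other [i] occurs once in either
   summand, with opposite signs. *)
rewrite /kdiff [X in _ *: X](bigD1 t) //= setD1K // mulr1 scalerDr scalerA.
rewrite ksgn_sqr scale1r addrC -addrA [X in _ + X]addrC scaler_sumr.
rewrite [X in _ + (_ + X)](eq_bigl (fun i => i \notin A)); last first.
  by move=> i; rewrite !inE negb_and negbK; case: eqP => [->|] //=; rewrite ?tA ?andbT ?andbF.
rewrite -big_split big1 ?addr0 //= => i iA.
have it : i != t by apply: contraNneq iA => ->.
have iB : i \notin A :\ t by rewrite !inE negb_and iA orbT.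
rewrite !mulr1 in_setU1 tA orbT.
have -> : (i |: A) :\ t = i |: (A :\ t).
  apply/setP=> a; rewrite !inE; case: (a =P i) => [->|] //=; by rewrite it.
rewrite !scalerA -scalerDl -[in ksgn i A](setD1K tA).
have := ksgn_swap iB tB it; rewrite [ksgn i (A :\ t) * _]mulrC.
rewrite !ksgnU //; case: (ltngtP i t) => [||/val_inj e]; last by rewrite e eqxx in it.
  by move=> _ _; rewrite mulrN mulrC addrC subrr scale0r.
by move=> _ _; rewrite mulNr mulrC addNr scale0r.
Qed.

End KoszulDifferential.

(** * Multigraded strands of polynomials *)

Section Strands.
Variables (k : fieldType) (n : nat).
Local Notation S := {mpoly k[n]}.
Implicit Types (f g : S) (b d e m : 'X_{1..n}) (A : {set 'I_n}).

Lemma mcoeffXM e f m :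
  ('X_[e] * f)@_m = if (e <= m)%MM then f@_(m - e) else 0.
Proof.
rewrite mulrC; case: ifP => [le|nle]; first by rewrite -{1}(submK le) addmC mcoeffMX.
apply/eqP; rewrite mcoeff_eq0 (perm_mem (msuppMX _ _)).
by apply/mapP => -[m' _ E]; rewrite E lem_addr in nle.
Qed.

(* Coefficient of f e_d in multidegree b, where e_d has multidegree d. *)
Definition strand f d b : k := if (d <= b)%MM then f@_(b - d) else 0.

Lemma strandD f g d b : strand (f + g) d b = strand f d b + strand g d b.
Proof. by rewrite /strand; case: ifP; rewrite ?mcoeffD ?addr0. Qed.

Lemma strand0 d b : strand 0 d b = 0.
Proof. by rewrite /strand mcoeff0 if_same. Qed.

Lemma strandZ (a : k) f d b : strand (a *: f) d b = a * strand f d b.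
Proof. by rewrite /strand; case: ifP; rewrite ?mcoeffZ ?mulr0. Qed.

Lemma strand_sum (T : finType) (P : pred T) (F : T -> S) d b :
  strand (\sum_(i | P i) F i) d b = \sum_(i | P i) strand (F i) d b.
Proof.
by apply: (big_morph (fun f => strand f d b)) => [f g|]; rewrite (strandD, strand0).
Qed.

Lemma strandXM e f d b : strand ('X_[e] * f) d b = strand f (d + e)%MM b.
Proof.
rewrite /strand; case: (boolP (d <= b)%MM) => [db|ndb].
  rewrite mcoeffXM -[in (d + e <= b)%MM](submK db) addmC.
  have -> : (e + d <= b - d + d)%MM = (e <= b - d)%MM.
    apply/mnm_lepP/mnm_lepP => h i; move: (h i); rewrite !mnmDE.
      by rewrite leq_add2r.
    by rewrite leq_add2r.
  case: ifP => // _; congr (_@__); apply/mnmP => i; rewrite !mnmE.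
  by rewrite -subnDA addnC.
case: ifP => // h; case/negP: ndb; exact: lepm_trans (lem_addr _ _) h.
Qed.

Lemma strandX e d b : (d <= e)%MM -> strand 'X_[e - d] d b = (e == b)%:R.
Proof.
move=> de; rewrite /strand mcoeffX; case: ifP => [db|].
  congr (nat_of_bool _)%:R; apply/eqP/eqP => [E|->//].
  by rewrite -(submK de) E submK.
by case: eqP => // <-; rewrite de.
Qed.

Lemma strand_shift f d m : strand f d (m + d)%MM = f@_m.
Proof. by rewrite /strand lem_addl addmK. Qed.

Lemma strand_inj f g d : (forall b, strand f d b = strand g d b) -> f = g.
Proof. by move=> h; apply/mpolyP => m; rewrite -!(strand_shift _ d). Qed.

(** A polynomial with prescribed strands; the bound [N] on total degrees keeps the sum finite. *)
Definition assemble N d (y : 'X_{1..n} -> k) : S :=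
  \sum_(b : 'X_{1..n < N} | (d <= b)%MM) y b *: 'X_[b - d].

Lemma strand_assemble N d y b :
  strand (assemble N d y) d b = if (d <= b)%MM && (mdeg b < N)%N then y b else 0.
Proof.
rewrite strand_sum.
rewrite (eq_bigr (fun c : 'X_{1..n < N} => y c * (val c == b)%:R)); last first.
  by move=> c dc; rewrite strandZ strandX.
case: ifP => [/andP[db bN]|nb].
  rewrite (bigD1 (BMultinom bN)) //= eqxx mulr1 big1 ?addr0 // => c /andP[_ ne].
  by move: ne; rewrite bmeqP /= => /negbTE ->; rewrite mulr0.
rewrite big1 // => c dc; case: eqP nb => [<-|]; rewrite ?mulr0 //.
by rewrite dc bmdeg.
Qed.

End Strands.

(** * Upper Koszul complexes *)

Section SimplicialHomology.
Variables (k : fieldType) (n : nat).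
Local Notation S := {mpoly k[n]}.
Implicit Types (f g : S) (b d e m u : 'X_{1..n}) (A : {set 'I_n}).
Implicit Types (P : pred 'X_{1..n}).

Lemma mesym1U i A : i \notin A -> mesym1 (i |: A) = (mesym1 A + U_(i))%MM.
Proof.
move=> iA; apply/mnmP => j; rewrite !mnmE in_setU1 eq_sym.
by case: eqP => [<-|_]; rewrite ?addn0 // (negbTE iA).
Qed.

Lemma mesym1D1 i A : i \in A -> mesym1 A = (mesym1 (A :\ i) + U_(i))%MM.
Proof. by move=> iA; rewrite -{1}(setD1K iA) mesym1U ?setD11. Qed.

Definition sdiff (y : {set 'I_n} -> k) : {set 'I_n} -> k :=
  kdiff (V := k^o) (fun=> 1) y.

Lemma eq_sdiff y z : y =1 z -> sdiff y =1 sdiff z.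
Proof. exact: (@eq_kdiff _ _ k^o). Qed.

Lemma sdiff0 A : sdiff (fun=> 0) A = 0.
Proof. exact: (kdiff0 k^o). Qed.

Lemma sdiffB y z A : sdiff (fun B => y B - z B) A = sdiff y A - sdiff z A.
Proof. exact: (@kdiffB _ _ k^o). Qed.

Lemma sdiff_sdiff y A : sdiff (sdiff y) A = 0.
Proof. exact: (@kdiff_kdiff _ _ k^o). Qed.

(* The faces of size l of the upper Koszul complex
   { A | x^b / x^A lies in the monomial ideal P } of Miller and Sturmfels. *)
Definition supported P b l (y : {set 'I_n} -> k) := forall A,
  y A != 0 -> [/\ #|A| = l, (mesym1 A <= b)%MM & P (b - mesym1 A)%MM].

(* Vanishing of its reduced homology in dimension l - 1. *)
Definition acyclic P b l := forall y, supported P b l y -> sdiff y =1 (fun=> 0) ->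
  exists2 z, supported P b l.+1 z & y =1 sdiff z.

(** A cycle is the boundary of its cone from [t], by [kcone_homotopy]; the hypotheses keep the faces
    of this cone inside the complex. *)
Lemma acyclic_cone P b l t : (0 < b t)%N ->
  (forall A, #|A| = l -> t \notin A -> (mesym1 A <= b)%MM -> P (b - mesym1 A)%MM ->
     (mesym1 (t |: A) <= b)%MM -> P (b - mesym1 (t |: A))%MM) ->
  acyclic P b l.
Proof.
move=> bt cone y sy dy; exists (kcone (V := k^o) t y) => A; last first.
  rewrite -[LHS](kcone_homotopy (V := k^o) t) [X in _ + X](_ : _ = 0) ?addr0 //.
  by rewrite /kcone; case: ifP => // _; rewrite [kdiff _ _ _]dy scaler0.
rewrite /kcone; case: ifP => [tA|]; last by rewrite eqxx.
rewrite [_ *: _]/(_ * _) mulf_eq0 negb_or => /andP[_ /sy[cA le PA]].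
have lA : (mesym1 A <= b)%MM.
  apply/mnm_lepP => i; rewrite (mesym1D1 tA) mnmDE mnm1E.
  have := mnm_lepP le i; case: eqP => [<-|]; rewrite ?addn0 //.
  by rewrite !mnmE setD11.
split=> //; first by rewrite (cardsD1 t) tA cA.
by have := cone _ cA; rewrite setD1K //; apply; rewrite ?setD11.
Qed.

Lemma acyclic_predT l b : (0 < l + mdeg b)%N -> acyclic predT b l.
Proof.
move=> lb; have [/eqP|b0] := eqVneq (mdeg b) 0%N; last first.
  have /existsP[t bt] : [exists t, 0 < b t]%N.
    apply: contraNT b0; rewrite negb_exists mdegE => /forallP h.
    by rewrite big1 // => i _; apply/eqP; have := h i; rewrite lt0n negbK.
  exact: (acyclic_cone bt).
(* In degree 0 the only face is the empty one, while [lb] forces [l > 0]. *)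
rewrite mdeg_eq0 => /eqP b0 y sy _; exists (fun=> 0) => [A|A]; first by rewrite eqxx.
rewrite sdiff0; apply/eqP/negPn/negP => /sy[cA le _].
suff : (mdeg (mesym1 A) = 0)%N by rewrite mdeg_mesym1 cA; move: lb; rewrite b0 mdeg0; lia.
rewrite mdegE big1 // => i _; have := mnm_lepP le i.
by rewrite b0 mnm0E leqn0 => /eqP.
Qed.

Lemma strand_sign r f d b : strand ((-1) ^+ r * f) d b = (-1) ^+ r * strand f d b.
Proof.
rewrite -[X in X * f]signr_odd -[X in X * strand _ _ _]signr_odd.
case: (odd r); rewrite ?expr1 ?expr0 ?mul1r //.
by rewrite !mulN1r -scaleN1r strandZ mulN1r.
Qed.

Definition pdiff (c : {set 'I_n} -> S) : {set 'I_n} -> S :=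
  kdiff (V := S^o) (fun i => 'X_i) c.

(** The Koszul basis element e_A has multidegree x^A, so multiplication by a variable becomes the
    weight 1 on strands. *)
Lemma strand_pdiff (c : {set 'I_n} -> S) A b :
  strand (pdiff c A) (mesym1 A) b = sdiff (fun B => strand (c B) (mesym1 B) b) A.
Proof.
rewrite strand_sum; apply: eq_bigr => i iA.
by rewrite -[_ *: _]mulrA strand_sign strandXM mesym1U // mulr1.
Qed.

Definition pchain P l j (c : {set 'I_n} -> S) := forall A u,
  (c A)@_u != 0 -> [/\ #|A| = l, (mdeg u + l)%N = j & P u].

Lemma strand_supported P l j c b : pchain P l j c ->
  supported P b l (fun A => strand (c A) (mesym1 A) b).
Proof.
move=> cc A; rewrite /strand; case: ifP => [le|]; last by rewrite eqxx.
by case/cc.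
Qed.

(** The Koszul differential preserves multidegrees: a bounding chain is found in each of the
    finitely many [b] of degree [j], and these are reassembled. *)
Lemma acyclic_pchain P l j c : (forall b, mdeg b = j -> acyclic P b l) ->
  pchain P l j c -> pdiff c =1 (fun=> 0) ->
  exists2 e, pchain P l.+1 j e & c =1 pdiff e.
Proof.
move=> ac cc dc; pose y b A := strand (c A) (mesym1 A) b.
have sy b : supported P b l (y b) by exact: strand_supported cc.
have dy b : sdiff (y b) =1 (fun=> 0).
  by move=> A; rewrite -strand_pdiff dc strand0.
have /fin_all_exists[z zP] (b : 'X_{1..n < j.+1}) : exists z : {set 'I_n} -> k,
    mdeg b = j -> supported P b l.+1 z /\ y b =1 sdiff z.
  case: (mdeg b =P j) => [/ac/(_ (y b)) []//|ne]; last by exists (fun=> 0).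
  by move=> z sz yz; exists z.
pose Z b A := if insub b is Some b' then
  if mdeg b == j then z b' A else 0 else 0.
have ZP b : supported P b l.+1 (Z b).
  move=> A; rewrite /Z; case: insubP => [b' _ <-|]; last by rewrite eqxx.
  by case: ifP => [/eqP e|_]; rewrite ?eqxx //; case: (zP _ e) => sz _ /sz.
exists (fun A => assemble j.+1 (mesym1 A) (fun b => Z b A)).
  move=> A u; rewrite -(strand_shift _ (mesym1 A)) strand_assemble.
  case: ifP => [_|]; last by rewrite eqxx.
  move=> nz; have [cA _] := ZP _ _ nz; rewrite addmK => Pu; split=> //.
  move: nz; rewrite /Z; case: insubP => [b' _ _|]; last by rewrite eqxx.
  by rewrite mdegD mdeg_mesym1 cA; case: ifP => [/eqP//|]; rewrite eqxx.
move=> A; apply: (strand_inj (d := mesym1 A)) => b; rewrite strand_pdiff -/(y b A).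
rewrite [RHS](eq_sdiff (z := Z b)); last first.
  move=> B; rewrite strand_assemble; case: ifP => // h.
  case: (Z b B =P 0) => [-> //|/eqP nz]; have [_ le _] := ZP _ _ nz.
  move: h nz; rewrite le /= /Z; by case: insubP => [b' ->|].
case: (mdeg b =P j) => [bj|ne].
  have bl : (mdeg b < j.+1)%N by rewrite bj.
  rewrite (proj2 (zP (BMultinom bl) bj)); apply: eq_sdiff => B.
  by rewrite /Z insubT bj eqxx.
have -> : y b A = 0.
  rewrite /y /strand; case: ifP => // le; apply/eqP; apply: contra_notT ne.
  by case/cc=> cA <- _; rewrite -cA -mdeg_mesym1 -mdegD submK.
rewrite (eq_sdiff (z := fun=> 0)) ?sdiff0 // => B.
by rewrite /Z; case: insubP => // b' _ _; case: eqP.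
Qed.

(** A simplicial cycle [y] is the strand at [b] of the Koszul cycle with coefficients y_A x^b / x^A,
    all of whose other strands vanish. *)
Lemma pchain_acyclic P l j : (forall c, pchain P l j c -> pdiff c =1 (fun=> 0) ->
    exists2 e, pchain P l.+1 j e & c =1 pdiff e) ->
  forall b, mdeg b = j -> acyclic P b l.
Proof.
move=> ac b bj y sy dy.
pose c A := if (mesym1 A <= b)%MM then y A *: 'X_[b - mesym1 A] else 0 : S.
have cE A b' : strand (c A) (mesym1 A) b' = if b' == b then y A else 0.
  rewrite /c; case: ifP => [le|nle].
    by rewrite strandZ strandX // eq_sym; case: eqP; rewrite ?mulr1 ?mulr0.
  rewrite strand0; case: eqP => // _; apply/eqP; rewrite eq_sym.
  by apply: contraFT nle => /sy[].
have cP : pchain P l j c.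
  move=> A u; rewrite -(strand_shift _ (mesym1 A)) cE.
  case: ifP => [/eqP bE|]; last by rewrite eqxx.
  case/sy => cA _; rewrite -bE addmK => Pu; split=> //.
  by rewrite -cA -mdeg_mesym1 -mdegD bE.
have dc : pdiff c =1 (fun=> 0).
  move=> A; apply: (strand_inj (d := mesym1 A)) => b'; rewrite strand_pdiff strand0.
  case: (b' =P b) => [->|ne].
    by rewrite -(dy A); apply: eq_sdiff => B; rewrite cE eqxx.
  rewrite (eq_sdiff (z := fun=> 0)) ?sdiff0 // => B.
  by rewrite cE; case: eqP.
have [e eP ce] := ac c cP dc.
exists (fun A => strand (e A) (mesym1 A) b); first exact: strand_supported eP.
by move=> A; rewrite -strand_pdiff -ce cE eqxx.
Qed.

End SimplicialHomology.

(** * Koszul homology of graded modules *)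

Section KoszulRows.
Variables (k : fieldType) (n : nat).
Local Notation S := {mpoly k[n]}.
Implicit Types (f q : S) (b d u : 'X_{1..n}) (A : {set 'I_n}).

Lemma sum_neq0 (V : nmodType) (T : finType) (Q : pred T) (F : T -> V) :
  \sum_(i | Q i) F i != 0 -> exists2 i, Q i & F i != 0.
Proof.
move=> nz; have [/exists_inP[i Qi Fi]|h] := boolP [exists (i | Q i), F i != 0].
  by exists i.
move: nz; rewrite big1 ?eqxx // => i Qi; apply/eqP.
by move: h; rewrite negb_exists => /forallP/(_ i); rewrite Qi negbK.
Qed.

Definition trunc (Q : pred 'X_{1..n}) f : S :=
  assemble (msize f) 0%MM (fun u => if Q u then f@_u else 0).

Lemma mcoeff_trunc Q f u : (trunc Q f)@_u = if Q u then f@_u else 0.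
Proof.
rewrite -(strand_shift _ 0%MM) strand_assemble addm0 (_ : (0 <= u)%MM).
  case: ltnP => //= h; have -> : f@_u = 0.
    by apply/eqP; rewrite mcoeff_eq0; apply: contraL h => /msize_mdeg_lt; rewrite ltnNge.
  by rewrite if_same.
by apply/mnm_lepP => i; rewrite mnm0E.
Qed.

(** [Q] and [R] play the role of one degree condition before and after multiplication by a
    homogeneous [q]. *)
Lemma mcoeff_trunc_mul (Q R : pred 'X_{1..n}) f q u :
  (forall u1 u2, q@_u2 != 0 -> Q u1 = R (u1 + u2)%MM) ->
  (trunc Q f * q)@_u = if R u then (f * q)@_u else 0.
Proof.
move=> QR; rewrite !mcoeffM; case: ifP => Ru.
  apply: eq_bigr => -[u1 u2] /eqP /= uE.
  have [->|/QR h] := eqVneq q@_u2 0; first by rewrite !mulr0.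
  by rewrite mcoeff_trunc h -uE Ru.
apply: big1 => -[u1 u2] /eqP /= uE.
have [->|/QR h] := eqVneq q@_u2 0; first by rewrite mulr0.
by rewrite mcoeff_trunc h -uE Ru mul0r.
Qed.

Lemma pdiff_mcoeff_neq0 (c : {set 'I_n} -> S) A u : (pdiff c A)@_u != 0 ->
  exists i, [/\ i \notin A, (U_(i) <= u)%MM & (c (i |: A))@_(u - U_(i)) != 0].
Proof.
rewrite raddf_sum /= => /sum_neq0[i iA].
rewrite -[_ *: _]mulrA -(strand_shift _ 0%MM) strand_sign mulf_eq0 negb_or.
rewrite strand_shift mcoeffXM => /andP[_]; case: ifP => [iu nz|]; last by rewrite eqxx.
by exists i.
Qed.

Section Rows.
Variables (m : nat) (g : 'I_m -> nat).
Implicit Types (c : {set 'I_n} -> 'rV[S]_m) (Z : 'rV[S]_m -> Prop).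

(* Chains of K_l (x) (+)_a S(- g a) of total degree j. *)
Definition rchain l j c := forall A a u,
  (c A 0 a)@_u != 0 -> #|A| = l /\ (mdeg u + l + g a)%N = j.

Definition rdiff c : {set 'I_n} -> 'rV[S]_m := kdiff (fun i => 'X_i) c.

(* For l = 0 this asks that c lie in the image of rdiff, so that the Koszul
   complex of a free module is exact in every degree. *)
Definition rcycle l c :=
  rdiff c =1 (fun=> 0) /\ (l = 0%N -> forall A a, (c A 0 a)@_0 = 0).

(** For a graded submodule Z of F = (+)_a S(- g a), the convention in [rcycle] makes this the
    vanishing of Tor_(l+1)(F / Z, k) in degree [j], so that dimension shifting works down to
    [l = 0]. *)
Definition kvanish Z l j := forall c, rchain l j c -> (forall A, Z (c A)) ->
  rcycle l c -> exists e, [/\ rchain l.+1 j e, forall A, Z (e A) & c =1 rdiff e].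

Lemma rdiffE c A a : rdiff c A 0 a = pdiff (fun B => c B 0 a) A.
Proof. by rewrite summxE; apply: eq_bigr => i _; rewrite mxE. Qed.

Lemma rchain_eq0 l j c A : rchain l j c -> #|A| != l -> c A = 0.
Proof.
move=> cc; apply: contraNeq => nz; apply/eqP.
suff [a [u h]] : exists a u, (c A 0 a)@_u != 0 by case: (cc _ _ _ h).
have [a nza] : exists a, c A 0 a != 0.
  apply/existsP; apply: contraNT nz; rewrite negb_exists => /forallP h.
  by apply/eqP/rowP => a; rewrite mxE; apply/eqP/negPn/h.
exists a, (mlead (c A 0 a)); by rewrite mleadc_eq0.
Qed.

Lemma rchain_rdiff l j c : rchain l.+1 j c -> rchain l j (rdiff c).
Proof.
move=> cc A a u; rewrite rdiffE => /pdiff_mcoeff_neq0[i [iA iu /cc[]]].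
rewrite cardsU1 iA => -[<-] <-; split=> //.
by rewrite -[in LHS](submK iu) mdegD mdeg1; lia.
Qed.

Lemma rdiff_mcoeff0 c A a : (rdiff c A 0 a)@_0 = 0.
Proof.
rewrite rdiffE; apply/eqP/negPn/negP => /pdiff_mcoeff_neq0[i [_]].
by rewrite lep1mP mnm0E.
Qed.

Lemma rcycle_rdiff l c : rcycle l (rdiff c).
Proof. by split=> [A|_ A a]; [exact: kdiff_kdiff | exact: rdiff_mcoeff0]. Qed.

Lemma rchainB l j c c' : rchain l j c -> rchain l j c' -> rchain l j (fun A => c A - c' A).
Proof.
move=> h h' A a u; rewrite !mxE mcoeffB.
have [|/h //] := eqVneq (c A 0 a)@_u 0; rewrite /= => ->.
by rewrite sub0r oppr_eq0 => /h'.
Qed.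

(** Each coordinate is a chain of the Koszul complex of S itself, whose upper Koszul complexes are
    full simplices. *)
Lemma rdiff_exact l j c : rchain l j c -> rcycle l c ->
  exists2 e, rchain l.+1 j e & c =1 rdiff e.
Proof.
move=> cc [dc c0].
have cE a : exists e : {set 'I_n} -> S, pchain predT l.+1 (j - g a) e
    /\ (fun A => c A 0 a) =1 pdiff e.
  (* The subtraction is truncated: the value 0 means [l = 0] and [j <= g a], where only constants
     could occur, and [rcycle] excludes them. *)
  have [lj|lj] := posnP (l + (j - g a)).
    exists (fun=> 0); split=> A; first by move=> u; rewrite mcoeff0 eqxx.
    rewrite [RHS]kdiff0; apply/mpolyP => u; rewrite mcoeff0.
    apply/eqP/negPn/negP => nz; have [cA uj] := cc _ _ _ nz.
    have u0 : u = 0%MM by apply/eqP; rewrite -mdeg_eq0; apply/eqP; lia.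
    by move: nz; rewrite u0 c0 ?eqxx //; lia.
  have := @acyclic_pchain _ _ predT l (j - g a) (fun A => c A 0 a).
  case.
  - by move=> b bj; apply: acyclic_predT; rewrite bj.
  - by move=> A u /cc[-> uj]; split=> //; lia.
  - by move=> A; rewrite -rdiffE dc mxE.
  by move=> e; exists e.
have [e eP] := fin_all_exists cE.
exists (fun A => \row_a e a A) => [A a u|A].
  by rewrite mxE => /((eP a).1)[-> uj _]; split=> //; lia.
apply/rowP => a; rewrite rdiffE (eP a).2.
by apply: (@eq_kdiff _ _ S^o) => B; rewrite mxE.
Qed.

End Rows.

(** * Dimension shifting along a homogeneous map *)

Section Shift.
Variables (m m' : nat) (g : 'I_m -> nat) (g' : 'I_m' -> nat) (D : 'M[S]_(m', m)).
Hypothesis homD : forall a (b : 'I_m) u, (D a b)@_u != 0 -> (mdeg u + g b)%N = g' a.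
Variables (Z : 'rV[S]_m -> Prop) (Z' : 'rV[S]_m' -> Prop).
Hypothesis imD : forall v, Z v <-> exists w, v = w *m D.
Hypothesis kerD : forall v, Z' v <-> v *m D = 0.

Lemma rdiff_mulmx (c : {set 'I_n} -> 'rV[S]_m') A :
  rdiff (fun B => c B *m D) A = rdiff c A *m D.
Proof. by rewrite mulmx_suml; apply: eq_bigr => i _; rewrite scalemxAl. Qed.

Lemma rchain_mulmx l j c : rchain g' l j c -> rchain g l j (fun A => c A *m D).
Proof.
move=> cc A b u; rewrite mxE raddf_sum /= => /sum_neq0[a _].
rewrite mcoeffM => /sum_neq0[[u1 u2] /eqP /= uE].
by rewrite mulf_eq0 negb_or => /andP[/cc[cA ?] /homD ?]; split=> //; rewrite uE mdegD; lia.
Qed.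

(** As [D] is homogeneous, any preimage may be truncated to its component of the right degree. *)
Lemma row_lift l j (v : 'rV[S]_m) :
  (forall (b : 'I_m) u, (v 0 b)@_u != 0 -> (mdeg u + l + g b)%N = j) ->
  Z v ->
  exists2 w : 'rV[S]_m', forall a u, (w 0 a)@_u != 0 -> (mdeg u + l + g' a)%N = j & v = w *m D.
Proof.
move=> vd /imD[w vE].
exists (\row_a trunc (fun u => mdeg u + l + g' a == j)%N (w 0 a)) => [a u|].
  by rewrite mxE mcoeff_trunc; case: ifP => [/eqP //|]; rewrite eqxx.
apply/rowP => b; apply/mpolyP => u; rewrite [in RHS]mxE raddf_sum /=.
rewrite (eq_bigr (fun a => if (mdeg u + l + g b == j)%N then (w 0 a * D a b)@_u else 0)).
  case: (_ =P j) => [_|h]; first by rewrite vE [in LHS]mxE raddf_sum.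
  by rewrite big1 //; apply/eqP/negPn/negP => /vd.
move=> a _; rewrite mxE (mcoeff_trunc_mul (R := fun u => mdeg u + l + g b == j)%N) //.
by move=> u1 u2 /homD <-; rewrite mdegD; congr (_ == _); lia.
Qed.

Lemma rchain_lift l j c : rchain g l j c -> (forall A, Z (c A)) ->
  exists2 c' : {set 'I_n} -> 'rV[S]_m', rchain g' l j c' & forall A, c A = c' A *m D.
Proof.
move=> cc Zc.
have /fin_all_exists[c' c'P] A : exists w : 'rV[S]_m',
    (forall a u, (w 0 a)@_u != 0 -> #|A| = l /\ (mdeg u + l + g' a)%N = j)
    /\ c A = w *m D.
  have [cA|cA] := eqVneq #|A| l; last first.
    exists 0; split=> [a u|]; first by rewrite mxE mcoeff0 eqxx.
    by rewrite mul0mx (rchain_eq0 cc cA).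
  have [|w wd ->] := row_lift (l := l) (j := j) _ (Zc A).
    by move=> b u /cc[_].
  by exists w; split=> // a u /wd.
exists c' => [A a u|A]; first by apply: (c'P A).1.
exact: (c'P A).2.
Qed.

Lemma rdiff_ker (c : {set 'I_n} -> 'rV[S]_m) : rdiff c =1 (fun=> 0) ->
  forall c' : {set 'I_n} -> 'rV[S]_m',
  (forall A, c A = c' A *m D) -> forall A, Z' (rdiff c' A).
Proof.
move=> dc c' cE A; apply/kerD; rewrite -rdiff_mulmx -[RHS](dc A).
by apply: eq_kdiff => B; rewrite cE.
Qed.

(* Dimension shifting along 0 -> ker D -> F -> im D -> 0, F being free. *)
Lemma kvanish_shift l j : kvanish g Z l.+1 j <-> kvanish g' Z' l j.
Proof.
split=> [vZ c cc Zc cyc|vZ c cc Zc [dc _]].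
  have [e ee cE] := rdiff_exact cc cyc.
  have [A||f [ff Zf eD]] := vZ (fun A => e A *m D) (rchain_mulmx ee).
  - by apply/imD; exists (e A).
  - by split=> // A; rewrite rdiff_mulmx -cE; apply/kerD.
  have [h hh fE] := rchain_lift ff Zf.
  (* Subtracting [rdiff h] moves [e] into the kernel of [D] without changing its boundary. *)
  exists (fun A => e A - rdiff h A); split.
  - exact/rchainB/rchain_rdiff.
  - move=> A; apply/kerD; rewrite mulmxBl eD -rdiff_mulmx.
    by rewrite [rdiff f A](eq_kdiff _ fE) subrr.
  - by move=> A; rewrite [RHS]kdiffB [kdiff _ (rdiff h) _]kdiff_kdiff subr0 cE.
have [h hh cE] := rchain_lift cc Zc.
(* The connecting map: the boundary of the lift [h] is a cycle in the kernel. Bounding it there by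
   [e] makes [h - e] a cycle over the free module. *)
have [e [ee Ze he]] := vZ _ (rchain_rdiff hh) (rdiff_ker dc cE) (rcycle_rdiff _ _).
have [||f ff hf] := @rdiff_exact _ g' l.+1 j (fun A => h A - e A).
- exact: rchainB.
- by split=> // A; rewrite [LHS]kdiffB [kdiff _ h _]he subrr.
exists (fun A => f A *m D); split.
- exact: rchain_mulmx.
- by move=> A; apply/imD; exists (f A).
- by move=> A; rewrite rdiff_mulmx -hf mulmxBl -cE (proj1 (kerD _) (Ze A)) subr0.
Qed.

End Shift.
End KoszulRows.

(** * Koszul homology compared with Tor computed from a resolution *)

Section Balancing.
Variables (k : fieldType) (n : nat).
Local Notation S := {mpoly k[n]}.
Implicit Types (f q : S) (u : 'X_{1..n}) (A : {set 'I_n}).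
Local Notation redk := (map_mx (mcoeff (0%MM : 'X_{1..n}))).

Definition conc m (v : 'rV[S]_m) : {set 'I_n} -> 'rV[S]_m :=
  fun A => if A == set0 then v else 0.

Lemma rchain_conc m (g : 'I_m -> nat) j (v : 'rV[S]_m) :
  (forall a u, (v 0 a)@_u != 0 -> (mdeg u + g a)%N = j) -> rchain g 0 j (conc v).
Proof.
move=> vj A a u; rewrite /conc; case: ifP => [/eqP ->|_]; last by rewrite mxE mcoeff0 eqxx.
by rewrite cards0 addn0 => /vj.
Qed.

Lemma rchain0_rdiff m (g : 'I_m -> nat) j (c : {set 'I_n} -> 'rV[S]_m) :
  rchain g 0 j c -> rdiff c =1 (fun=> 0).
Proof.
move=> cc A; apply: big1 => i iA.
by rewrite (rchain_eq0 cc) ?scaler0 // cardsU1 iA.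
Qed.

Lemma rchain_polyC m (g : 'I_m -> nat) j (v : 'rV[k]_m) :
  (forall a, v 0 a != 0 -> g a = j) -> rchain g 0 j (conc (map_mx (@mpolyC n k) v)).
Proof.
move=> vj; apply: rchain_conc => a u; rewrite mxE mcoeffC.
by case: (u =P 0%MM) => [->|_]; rewrite ?mulr0 ?eqxx // mulr1 mdeg0 => /vj.
Qed.

Lemma redk_polyC m (v : 'rV[k]_m) : redk (map_mx (@mpolyC n k) v) = v.
Proof. by apply/rowP => a; rewrite !mxE mpolyCK. Qed.

Section LowDegree.
Variables (m m' m'' : nat).
Variables (g : 'I_m -> nat) (g' : 'I_m' -> nat) (g'' : 'I_m'' -> nat).
Variables (D : 'M[S]_(m', m)) (D' : 'M[S]_(m'', m')).
Hypothesis homD : forall a (b : 'I_m) u, (D a b)@_u != 0 -> (mdeg u + g b)%N = g' a.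
Hypothesis homD' : forall a (b : 'I_m') u,
  (D' a b)@_u != 0 -> (mdeg u + g' b)%N = g'' a.
Variable Z : 'rV[S]_m -> Prop.
Hypothesis imD : forall v, Z v <-> exists w, v = w *m D.
Hypothesis exD : forall v : 'rV[S]_m', v *m D = 0 <-> exists w, v = w *m D'.

(** A 0-cycle in the image of [D] lifts to a row whose constant terms are killed by [redk D]; it
    bounds exactly when these constant terms come from [D']. *)
Lemma kvanish0P j : kvanish g Z 0 j <->
  forall v : 'rV[k]_m', (forall a, v 0 a != 0 -> g' a = j) -> v *m redk D = 0 ->
  exists2 w : 'rV[k]_m'', (forall a, w 0 a != 0 -> g'' a = j) & v = w *m redk D'.
Proof.
split=> [vZ v vj vD|vH c cc Zc [_ c0]].
  have cv := rchain_polyC vj; set V := map_mx _ v in cv.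
  have cVD := rchain_mulmx homD cv.
  have [||e [ee Ze he]] := vZ _ cVD.
  - by move=> A; apply/imD; exists (conc V A).
  - split; first exact: rchain0_rdiff cVD.
    move=> _ A a; rewrite /conc; case: eqP => _; last by rewrite mul0mx mxE mcoeff0.
    by have /rowP/(_ a) := vD; rewrite -[X in X *m _]redk_polyC -map_mxM !mxE.
  have [h hh eD] := rchain_lift homD imD ee Ze.
  have cw := rchainB cv (rchain_rdiff hh).
  (* The difference lies in the kernel of [D] and has the constant terms of [V], since a Koszul
     boundary has none. *)
  have [||w wj wE] := @row_lift _ _ _ _ g' g'' D' homD' (fun v => v *m D = 0) exD 0 j
    (conc V set0 - rdiff h set0).
  - by move=> a u /cw[].
  - rewrite mulmxBl -rdiff_mulmx; apply/eqP; rewrite subr_eq0; apply/eqP.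
    by rewrite [LHS]he; apply: eq_kdiff.
  exists (redk w) => [a|]; first by rewrite mxE => /wj; rewrite mdeg0.
  rewrite -map_mxM -wE; apply/rowP => a.
  by rewrite !mxE raddfB /= rdiff_mcoeff0 subr0 /conc eqxx !mxE mpolyCK.
have [h hh cD] := rchain_lift homD imD cc Zc.
(* Conversely, correcting the lift [h] by the image of [w] under [D'] removes its constant terms,
   which makes it a Koszul boundary. *)
have [||w wj wE] := vH (redk (h set0)).
- by move=> a; rewrite mxE => /hh[_]; rewrite mdeg0.
- by rewrite -map_mxM -cD; apply/rowP => a; rewrite !mxE; exact: c0.
have cw := rchain_mulmx homD' (rchain_polyC wj); set W := map_mx _ w in cw.
have ce := rchainB hh cw.
have [|f ff hf] := rdiff_exact ce.
  split=> [|_ A a]; first exact: rchain0_rdiff ce.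
  have [->|A0] := eqVneq A set0; last first.
    by rewrite (rchain_eq0 ce) ?cards_eq0 // mxE mcoeff0.
  have wa : (h set0 0 a)@_0 = ((W *m D') 0 a)@_0.
    have /rowP/(_ a) := wE; rewrite -[X in X *m redk D']redk_polyC -map_mxM.
    by rewrite mxE [in RHS]mxE.
  by rewrite mxE [X in _ + X]mxE raddfB /= wa /conc eqxx subrr.
exists (fun A => f A *m D); split.
- exact (rchain_mulmx homD ff).
- by move=> A; apply/imD; exists (f A).
move=> A; rewrite rdiff_mulmx -hf mulmxBl cD [X in _ - X](_ : _ = 0) ?subr0 //.
by apply/exD; exists (conc W A).
Qed.

End LowDegree.

Section Resolution.
Variables (I : S -> Prop) (F : graded_free_resolution I).
Hypothesis I0 : forall f, I f -> f@_0 = 0.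

Let Z (v : 'rV[S]_1) := I (v 0 0).
Let g (_ : 'I_1) := 0%N.

Lemma aug_deg a (b : 'I_1) u : (aug F a b)@_u != 0 -> (mdeg u + g b)%N = gdeg a.
Proof.
rewrite (ord1 b) addn0 -mcoeff_msupp => /dhomogP; apply; exact: aug_homog.
Qed.

Lemma diff_deg i a (b : 'I_(rk F i)) u :
  (diff F i a b)@_u != 0 -> (mdeg u + gdeg b)%N = gdeg a.
Proof.
have := diff_homog a b; case: leqP => [le /dhomogP h|_ /eqP ->].
  by rewrite -mcoeff_msupp => /h ->; rewrite subnK.
by rewrite mcoeff0 eqxx.
Qed.

Definition syz i : 'rV[S]_(rk F i) -> Prop :=
  match i with
  | 0 => fun v => v *m aug F = 0
  | i'.+1 => fun v => v *m diff F i' = 0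
  end.

Lemma im_aug v : Z v <-> exists w, v = w *m aug F.
Proof.
rewrite /Z aug_image; split=> -[w wE]; exists w.
  by rewrite wE -mx11_scalar.
by rewrite -wE -mx11_scalar.
Qed.

Lemma im_diff i v : syz v <-> exists w, v = w *m diff F i.
Proof. by case: i v => [|i] v; [exact: exact_aug | exact: exact_diff]. Qed.

Lemma kvanish_syz i l j : kvanish (@gdeg _ _ _ F i) (@syz i) l j <->
  kvanish g Z (i + l).+1 j.
Proof.
elim: i l => [|i IH] l.
  by rewrite -(kvanish_shift (@aug_deg) im_aug (fun v => iff_refl (syz v))).
rewrite addSnnS -IH.
by rewrite (kvanish_shift (@diff_deg i) (@im_diff i) (fun v => iff_refl (@syz i.+1 v))).
Qed.

(** Balancing of Tor: [kvanish_syz] trades Koszul degree for syzygies until degree 0 is reached,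
    where [kvanish0P] applies. The left side does not mention [F]. *)
Lemma kvanish_homologyk i j : kvanish g Z i j <-> homologyk_eq0 F i j.
Proof.
case: i => [|i].
  rewrite (kvanish0P (@aug_deg) (@diff_deg 0) im_aug (@exact_aug _ _ _ F)).
  split=> [h v vj _|h v vj _]; apply: h => //.
  (* The entries of [aug F] lie in [I], hence have no constant term. *)
  have -> : redk (aug F) = 0; last by rewrite mulmx0.
  apply/matrixP => a b; rewrite !mxE (ord1 b); apply: I0; apply/(aug_image F).
  exists (delta_mx 0 a); rewrite -rowE; apply/rowP => c; rewrite !mxE (ord1 c).
  by rewrite mulr1n.
have := kvanish_syz i 0 j; rewrite addn0 => <-.
by rewrite (kvanish0P (@diff_deg i) (@diff_deg i.+1) (@im_diff i) (@exact_diff _ _ _ F i)).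
Qed.

End Resolution.

Definition mono_ideal (P : pred 'X_{1..n}) f := forall u, f@_u != 0 -> P u.

(** As 1 is not in the ideal, the condition on constant terms in [rcycle] is automatic. *)
Lemma kvanish_acyclic P i j : ~~ P 0%MM ->
  kvanish (fun _ : 'I_1 => 0%N) (fun v => mono_ideal P (v 0 0)) i j <->
  forall b, mdeg b = j -> acyclic k P b i.
Proof.
move=> P0; split=> [vZ|ac c cc Zc [dc _]].
  apply: pchain_acyclic => c cP dc.
  have [|||e [ee Ze he]] := vZ (fun A => (c A)%:M).
  - by move=> A a u; rewrite mxE (ord1 a) => /cP[]; lia.
  - by move=> A u; rewrite mxE => /cP[].
  - split=> [A|_ A a].
      apply/rowP => a; rewrite rdiffE mxE -[RHS](dc A).
      by apply: (@eq_kdiff _ _ S^o) => B; rewrite mxE (ord1 a).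
    apply/eqP/negPn/negP; rewrite mxE (ord1 a) => /cP[_ _].
    by rewrite (negbTE P0).
  exists (fun A => e A 0 0) => [A u nz|A].
    have [cA uj] := ee _ _ _ nz; split=> //; [lia | exact: Ze nz].
  by have /rowP/(_ 0) := he A; rewrite rdiffE mxE.
have [||e eP he] := @acyclic_pchain _ _ P i j (fun A => c A 0 0) ac.
- move=> A u nz; have [cA uj] := cc _ _ _ nz; split=> //; [lia | exact: Zc nz].
- by move=> A; rewrite -rdiffE dc mxE.
exists (fun A => (e A)%:M); split.
- by move=> A a u; rewrite mxE (ord1 a) => /eP[]; lia.
- by move=> A u; rewrite mxE => /eP[].
move=> A; apply/rowP => a; rewrite rdiffE (ord1 a) he.
by apply: (@eq_kdiff _ _ S^o) => B; rewrite mxE.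
Qed.

End Balancing.

(** * Multigraded resolutions of monomial ideals *)

Section MonomialResolution.
Variables (k : fieldType) (n : nat) (N : nat).
Local Notation S := {mpoly k[n]}.
Local Notation mon := 'X_{1..n}.
Implicit Types (f q : S) (b c d u : mon).

(* All syzygies of P live in multidegrees bounded by N in each variable, so the
   components of the syzygy modules in degrees c and clip c coincide, and finitely
   many degrees generate: no appeal to Hilbert's basis theorem is needed. *)
Definition clip c : mon := [multinom minn (c i) N | i < n].

Lemma clip_le c : (clip c <= c)%MM.
Proof. by apply/mnm_lepP => i; rewrite mnmE geq_minl. Qed.

Lemma le_clip c b : (clip c <= clip b)%MM = (clip c <= b)%MM.
Proof.
apply/mnm_lepP/mnm_lepP => h i; move: (h i); rewrite !mnmE leq_min ?geq_minr ?andbT //.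
Qed.

Lemma clipK c : clip (clip c) = clip c.
Proof. by apply/mnmP => i; rewrite !mnmE -minnA minnn. Qed.

Lemma mdeg_clip c : (mdeg (clip c) < (n * N).+1)%N.
Proof.
rewrite ltnS mdegE -[n in (n * N)%N]card_ord -sum_nat_const leq_sum // => i _.
by rewrite mnmE geq_minr.
Qed.

(* A multigraded submodule of (+)_a S(- sdeg a), given by its component sV c in
   each multidegree c, as a row space. *)
Record stage := Stage {
  srk : nat;
  sdeg : 'I_srk -> mon;
  sV : mon -> 'M[k]_srk
}.

(** Rows of [sV s c] are coordinates in the basis x^c / x^(sdeg a) e_a, in which multiplication by a
    monomial is the identity; [sV_mono] is closure under it. *)
Record stage_ok (s : stage) : Prop := StageOk {
  sV_mono : forall c c', (c <= c')%MM -> (sV s c <= sV s c')%MS;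
  sV_clip : forall c, sV s (clip c) = sV s c;
  sV_deg : forall c i a, sV s c i a != 0 -> (sdeg a <= c)%MM
}.

Definition rstrand m (deg : 'I_m -> mon) b (v : 'rV[S]_m) : 'rV[k]_m :=
  \row_t strand (v 0 t) (deg t) b.

Definition stage_mod s v := forall b, (rstrand (@sdeg s) b v <= sV s b)%MS.

Lemma rstrand_inj m (deg : 'I_m -> mon) v w :
  (forall b, rstrand deg b v = rstrand deg b w) -> v = w.
Proof.
move=> h; apply/rowP => t; apply: (strand_inj (d := deg t)) => b.
by have /rowP/(_ t) := h b; rewrite !mxE.
Qed.

Lemma rstrand_mulmx m m' (deg : 'I_m -> mon) (deg' : 'I_m' -> mon) (A : 'M[k]_(m', m)) b v :
  (forall x t, A x t != 0 -> (deg t <= deg' x)%MM) ->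
  rstrand deg b (v *m \matrix_(x, t) (A x t *: 'X_[deg' x - deg t])) =
  rstrand deg' b v *m A.
Proof.
move=> Adeg; apply/rowP => t; rewrite !mxE strand_sum; apply: eq_bigr => x _.
rewrite !mxE -scalerAr strandZ mulrC [v 0 x * _]mulrC.
have [->|/Adeg le] := eqVneq (A x t) 0; first by rewrite !mulr0.
by rewrite strandXM addmC submK.
Qed.

Section NextStage.
Variable s : stage.
Let T : finType := ('X_{1..n < (n * N).+1} * 'I_(srk s))%type.

Definition next_idx (x : 'I_#|T|) : 'X_{1..n < (n * N).+1} * 'I_(srk s) := enum_val x.

Definition next_deg (x : 'I_#|T|) : mon := clip (next_idx x).1.

Definition next_mx : 'M[k]_(#|T|, srk s) :=
  \matrix_(x, t) sV s (next_idx x).1 (next_idx x).2 t.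

Definition next_mask c : 'M[k]_#|T| :=
  diag_mx (\row_x (next_deg x <= c)%MM%:R).

Definition next_stage := Stage next_deg (fun c => (kermx next_mx :&: next_mask c)%MS).

Definition next_diff : 'M[S]_(#|T|, srk s) :=
  \matrix_(x, t) (next_mx x t *: 'X_[next_deg x - sdeg t]).

Lemma mul_mask m (v : 'M[k]_(m, #|T|)) c i x :
  (v *m next_mask c) i x = if (next_deg x <= c)%MM then v i x else 0.
Proof.
rewrite /next_mask mul_mx_diag !mxE.
by case: ifP; rewrite ?mulr1 ?mulr0.
Qed.

Lemma sub_maskP m (v : 'M[k]_(m, #|T|)) c :
  reflect (forall i x, v i x != 0 -> (next_deg x <= c)%MM) (v <= next_mask c)%MS.
Proof.
apply: (iffP idP) => [/submxP[w ->] i x|h].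
  by rewrite mul_mask; case: ifP; rewrite ?eqxx.
suff -> : v = v *m next_mask c by rewrite submxMl.
apply/matrixP => i x; rewrite mul_mask; case: ifP => // /negP nle.
by apply/eqP/negPn/negP => /h.
Qed.

Lemma next_stage_ok : stage_ok next_stage.
Proof.
split=> [c c' cc'|c|c i a] /=.
- apply: capmxS => //; apply/sub_maskP => i x nz; apply: lepm_trans cc'.
  by have /sub_maskP := submx_refl (next_mask c); apply; exact: nz.
- congr (_ :&: diag_mx _)%MS; apply/rowP => x; rewrite !mxE.
  by rewrite /next_deg le_clip.
- by have /sub_maskP := capmxSr (kermx next_mx) (next_mask c); apply.
Qed.

Hypothesis s_ok : stage_ok s.

Lemma next_mx_deg x t : next_mx x t != 0 -> (sdeg t <= next_deg x)%MM.
Proof. by rewrite mxE -(sV_clip s_ok) => /(sV_deg s_ok). Qed.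

Lemma rstrand_mask b v : (rstrand next_deg b v <= next_mask b)%MS.
Proof.
apply/sub_maskP => i x; rewrite mxE /strand.
by case: ifP; rewrite ?eqxx.
Qed.

Lemma next_diff_ker v : stage_mod (s := next_stage) v <-> v *m next_diff = 0.
Proof.
split=> [vV|vD b]; last first.
  rewrite sub_capmx rstrand_mask andbT; apply/sub_kermxP.
  rewrite -(rstrand_mulmx _ _ next_mx_deg) -/next_diff vD.
  by apply/rowP => t; rewrite !mxE strand0.
apply: (rstrand_inj (deg := @sdeg s)) => b.
rewrite (rstrand_mulmx _ _ next_mx_deg).
have := vV b; rewrite sub_capmx => /andP[/sub_kermxP -> _].
by apply/rowP => t; rewrite !mxE strand0.
Qed.

Lemma next_diff_im v : stage_mod (s := s) v <-> exists w, v = w *m next_diff.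
Proof.
split=> [vV|[w ->] b]; last first.
  rewrite (rstrand_mulmx _ _ next_mx_deg) mulmx_sum_row summx_sub // => x _.
  rewrite mxE /strand; case: ifP => [le|_]; last by rewrite scale0r sub0mx.
  apply: scalemx_sub; rewrite (_ : row x next_mx = row (next_idx x).2 (sV s (next_idx x).1)).
    by apply: submx_trans (row_sub _ _) _; rewrite -(sV_clip s_ok) (sV_mono s_ok).
  by apply/rowP => t; rewrite !mxE.
(* All strands of [v] vanish from total degree [M] on, so [assemble] may stop there. *)
pose M := (\max_t (msize (v 0%R t) + mdeg (sdeg t)))%N.
have vM b : (M <= mdeg b)%N -> rstrand (@sdeg s) b v = 0.
  move=> Mb; apply/rowP => t; rewrite !mxE /strand; case: ifP => // le.
  apply/eqP; rewrite mcoeff_eq0; apply: contraL Mb => /msize_mdeg_lt h.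
  rewrite -ltnNge -(submK le) mdegD.
  have := leq_bigmax (F := fun t => (msize (v 0%R t) + mdeg (sdeg t))%N) t.
  by apply: leq_trans; rewrite ltn_add2r.
(* Coordinates of a strand on the rows of [sV s c]. In degree [b] only the generators coming from
   [clip b] are used; their rows span the component by [sV_clip]. *)
pose y b c i := (rstrand (@sdeg s) b v *m pinvmx (sV s c)) 0 i.
exists (\row_x assemble M (next_deg x) (fun b =>
  if bmnm (next_idx x).1 == clip b then y b (next_idx x).1 (next_idx x).2 else 0)).
apply: (rstrand_inj (deg := @sdeg s)) => b.
rewrite (rstrand_mulmx _ _ next_mx_deg) mulmx_sum_row.
have [bM|Mb] := ltnP (mdeg b) M; last first.
  rewrite vM // big1 // => x _; rewrite !mxE strand_assemble.
  by rewrite ltnNge Mb andbF scale0r.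
pose G (x : T) := (if bmnm x.1 == clip b then y b x.1 x.2 else 0) *:
  row x.2 (sV s x.1).
rewrite (eq_bigr (fun x => G (next_idx x))); last first.
  move=> x _; rewrite !mxE strand_assemble bM andbT /G; congr (_ *: _).
    by case: eqP => [e|]; rewrite ?if_same // /next_deg e clipK clip_le.
  by apply/rowP => t; rewrite !mxE.
rewrite -(big_enum_val G) /= -(pair_bigA _ (fun (c : 'X_{1..n < (n * N).+1}) i => G (c, i))) /=.
have cb := mdeg_clip b.
rewrite (bigD1 (BMultinom cb)) //= [X in _ + X]big1 ?addr0 => [|c ne]; last first.
  by rewrite big1 // => i _; rewrite /G /= -[_ == _]/(c == BMultinom cb) (negbTE ne) scale0r.
rewrite /G /= eqxx -(mulmx_sum_row (rstrand _ b v *m _)) mulmxKpV //.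
by rewrite (sV_clip s_ok).
Qed.

Lemma next_diff_homog (x : 'I_#|T|) (t : 'I_(srk s)) :
  if (mdeg (sdeg t) <= mdeg (next_deg x))%N
  then next_diff x t \is (mdeg (next_deg x) - mdeg (sdeg t)).-homog
  else next_diff x t == 0.
Proof.
rewrite mxE; have [->|/next_mx_deg le] := eqVneq (next_mx x t) 0.
  by rewrite scale0r eqxx dhomog0 if_same.
have le' : (mdeg (sdeg t) <= mdeg (next_deg x))%N.
  by rewrite -[X in (_ <= mdeg X)%N](submK le) mdegD leq_addl.
rewrite le' rpredZ // dhomogX /=; apply/eqP.
by rewrite -[X in (mdeg X - _)%N](submK le) mdegD addnK.
Qed.

End NextStage.

Variable P : pred mon.
Hypothesis P_up : forall c c', (c <= c')%MM -> P c -> P c'.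
Hypothesis P_clip : forall c, P (clip c) = P c.

(** Stage 0 is the ideal inside S: its component in degree [c] is the whole line or 0 according to
    [P c]. *)
Fixpoint stages i : stage :=
  if i is i'.+1 then next_stage (stages i')
  else @Stage 1 (fun=> 0%MM) (fun c => (P c)%:R%:M).

Lemma stages_ok i : stage_ok (stages i).
Proof.
case: i => [|i]; last exact: next_stage_ok.
split=> [c c' cc'|c|c x a _] /=; rewrite ?P_clip //.
  case: (boolP (P c)) => [/(P_up cc') ->|_]; first exact: submx_refl.
  by rewrite raddf0 sub0mx.
by apply/mnm_lepP => i; rewrite mnm0E.
Qed.

Lemma mono_resolution (I : S -> Prop) :
  (forall f, I f <-> mono_ideal P f) -> inhabited (graded_free_resolution I).
Proof.
move=> IP.
have mod0 (v : 'rV[S]_1) : @stage_mod (stages 0) v <-> I (v 0 0).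
  rewrite IP; split=> [vP u|vP b].
    have := vP (u + 0)%MM; rewrite /= addm0.
    rewrite /rstrand /=; case: (P u) => //.
    rewrite raddf0 submx0 => /eqP/rowP/(_ 0); rewrite !mxE -(addm0 u) strand_shift.
    by rewrite addm0 => ->; rewrite eqxx.
  rewrite /=; case: (boolP (P b)) => Pb; first exact: submx1.
  rewrite raddf0 submx0; apply/eqP/rowP => t; rewrite !mxE (ord1 t) -(addm0 b) strand_shift.
  by apply/eqP; apply: contraNT Pb => /vP.
have im := fun i => next_diff_im (stages_ok i).
have ker := fun i => next_diff_ker (stages_ok i).
split; refine (@GradedFreeResolution _ _ I (fun i => srk (stages i.+1))
  (fun i x => mdeg (sdeg x)) (next_diff (stages 0)) (fun i => next_diff (stages i.+1))
  _ _ _ _ _) => [x|i x t|f|v|i v].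
- by have := next_diff_homog (stages_ok 0) x ord0; rewrite /= mdeg0 subn0.
- exact: next_diff_homog (stages_ok i.+1) x t.
- have : I (f%:M 0 0 : S) <-> _ := iff_trans (iff_sym (mod0 f%:M)) (im 0%N f%:M).
  by rewrite mxE /= => ->; split=> -[w wE]; exists w.
- exact: iff_trans (iff_sym (ker 0%N v)) (im 1%N v).
- exact: iff_trans (iff_sym (ker i.+1 v)) (im i.+2 v).
Qed.

End MonomialResolution.

(** * Edge ideals *)

Section EdgeIdeals.
Variables (k : fieldType) (n : nat).
Local Notation mon := 'X_{1..n}.
Implicit Types (E : rel 'I_n) (b c u : mon) (A B : {set 'I_n}) (x y z t : 'I_n).

Definition edge_mono (E : rel 'I_n) : pred mon :=
  fun u => [exists i, exists j, E i j && (U_(i) + U_(j) <= u)%MM].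

Definition loopless (E : rel 'I_n) : rel 'I_n := fun i j => (i != j) && E i j.

Lemma edge_monoP (E : rel 'I_n) u :
  reflect (exists i j, E i j /\ (U_(i) + U_(j) <= u)%MM) (edge_mono E u).
Proof.
apply: (iffP existsP) => [[i /existsP[j /andP[]]]|[i [j [Eij le]]]]; first by exists i, j.
by exists i; apply/existsP; exists j; rewrite Eij.
Qed.

Lemma le_mnm2 x y u : x != y -> (U_(x) + U_(y) <= u)%MM = (0 < u x)%N && (0 < u y)%N.
Proof.
move=> xy; apply/mnm_lepP/andP => [h|[ux uy] i].
  split; [have := h x | have := h y]; rewrite mnmDE !mnm1E eqxx; lia.
rewrite mnmDE !mnm1E; case: (x =P i) => [<-|_]; last by case: eqP => [<-|].
by rewrite eq_sym (negbTE xy).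
Qed.

Lemma le_mnm11 x u : (U_(x) + U_(x) <= u)%MM = (1 < u x)%N.
Proof.
apply/mnm_lepP/idP => [/(_ x)|ux i]; first by rewrite mnmDE !mnm1E eqxx.
by rewrite mnmDE !mnm1E; case: eqP => [<-|].
Qed.

Lemma loopless_monoP (E : rel 'I_n) u :
  reflect (exists i j, [/\ i != j, E i j, (0 < u i)%N & (0 < u j)%N])
    (edge_mono (loopless E) u).
Proof.
apply: (iffP (edge_monoP _ _)) => -[i [j]].
  by case=> /andP[ij Eij]; rewrite le_mnm2 // => /andP[]; exists i, j.
by case=> ij Eij ui uj; exists i, j; rewrite /loopless ij Eij le_mnm2 // ui uj.
Qed.

Lemma edge_mono_loop E x u : E x x -> (1 < u x)%N -> edge_mono E u.
Proof. by move=> Exx ux; apply/edge_monoP; exists x, x; rewrite le_mnm11. Qed.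

Lemma edge_mono_loopless E u : edge_mono (loopless E) u -> edge_mono E u.
Proof. by case/edge_monoP => i [j [/andP[_ Eij] le]]; apply/edge_monoP; exists i, j. Qed.

Lemma edge_mono_square E u : edge_mono E u -> ~~ edge_mono (loopless E) u ->
  exists2 x, E x x & (1 < u x)%N.
Proof.
case/edge_monoP => i [j [Eij le]] nl; have [e|ij] := eqVneq i j.
  by exists i; [rewrite [in X in E _ X]e | rewrite -le_mnm11 [in X in (_ + X)%MM]e].
by case/edge_monoP: nl; exists i, j; rewrite /loopless ij.
Qed.

Lemma edge_mono_up E u c : (u <= c)%MM -> edge_mono E u -> edge_mono E c.
Proof.
move=> uc /edge_monoP[i [j [Eij le]]]; apply/edge_monoP; exists i, j; split=> //.
exact: lepm_trans uc.
Qed.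

Lemma mnm_mesym1 A i : mesym1 A i = (i \in A) :> nat.
Proof. by rewrite mnmE. Qed.

Lemma mesym1S A B : A \subset B -> (mesym1 A <= mesym1 B)%MM.
Proof.
move=> AB; apply/mnm_lepP => i; rewrite !mnm_mesym1.
by case: (boolP (i \in A)) => // /(subsetP AB) ->.
Qed.

Lemma subm_mono b u c : (u <= c)%MM -> (b - c <= b - u)%MM.
Proof.
move=> uc; apply/mnm_lepP => i; rewrite !mnmE; exact/leq_sub2l/(mnm_lepP uc).
Qed.

Lemma acyclic_ext (P Q : pred mon) b l : (forall u, (u <= b)%MM -> P u = Q u) ->
  acyclic k P b l -> acyclic k Q b l.
Proof.
move=> PQ ac y sy dy; have [|z sz yz] := ac y _ dy.
  by move=> A /sy[cA le QA]; split; rewrite ?PQ ?lem_subr.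
by exists z => // A /sz[cA le PA]; split; rewrite -?PQ ?lem_subr.
Qed.

Lemma acyclic_loopless E b l :
  acyclic k (edge_mono E) b l -> acyclic k (edge_mono (loopless E)) b l.
Proof.
move=> ac; case: (pickP (fun t => 1 < b t)%N) => [t bt|sq].
  (* For squarefree generators only the support matters, and [t] stays in it after one division
     since [b t >= 2]. *)
  apply: (acyclic_cone (t := t)) => [|A _ tA le]; first exact: ltnW.
  case/loopless_monoP => i [j [ij Eij ui uj]] _; apply/loopless_monoP; exists i, j.
  split=> //; [move: ui|move: uj]; rewrite !mnmBE !mnm_mesym1 in_setU1.
    by case: eqP => [->|//]; rewrite (negbTE tA); lia.
  by case: eqP => [->|//]; rewrite (negbTE tA); lia.
apply: acyclic_ext ac => u ub; apply/idP/idP => [Eu|]; last exact: edge_mono_loopless.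
apply: contraT => /(edge_mono_square Eu)[x _ ux].
by have := leq_trans ux (mnm_lepP ub x); rewrite sq.
Qed.

(** The condition on links in terms of edges: [y = z] makes distinct square vertices adjacent,
    [y != z] forbids edges among the non-neighbours of a square vertex. *)
Definition square_condition (E : rel 'I_n) :=
  forall x y z, E x x -> E y z -> E x y || E x z.

Lemma supported_sdiff (P : pred mon) b l (y : {set 'I_n} -> k) :
  (forall u c, (u <= c)%MM -> P u -> P c) ->
  supported P b l.+1 y -> supported P b l (sdiff y).
Proof.
move=> Pup sy A /sum_neq0[i iA].
rewrite [_ *: _]/(_ * _) mulf_eq0 negb_or => /andP[_ /sy[]]; rewrite cardsU1 iA => -[<-] le PA.
have AU : (mesym1 A <= mesym1 (i |: A))%MM by apply/mesym1S/subsetUr.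
split=> //; first exact: lepm_trans le.
exact/Pup/PA/subm_mono.
Qed.

Section Squares.
Variable E : rel 'I_n.
Hypotheses (Esym : ssrbool.symmetric E) (EC : square_condition E).
Local Notation E0 := (loopless E).

(* All faces of K^b(I) outside K^b(I_Delta) involve the same square vertex x.  As
   l + 2 < mdeg b, some t divides x^b / (x^2 x^A) for such a face A, and coning
   from t moves a cycle into K^b(I_Delta). *)
Lemma acyclic_squares b l : (l + 2 < mdeg b)%N ->
  acyclic k (edge_mono E0) b l -> acyclic k (edge_mono E) b l.
Proof.
move=> bl ac y sy dy.
pose K A := (mesym1 A <= b)%MM && edge_mono E0 (b - mesym1 A)%MM.
have K_sub A B : A \subset B -> K B -> K A.
  move=> /mesym1S AB /andP[le]; rewrite /K (lepm_trans AB le) /=.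
  exact/edge_mono_up/subm_mono.
have supU (z : {set 'I_n} -> k) :
    supported (edge_mono E0) b l.+1 z -> supported (edge_mono E) b l.+1 z.
  by move=> sz A /sz[? ? /edge_mono_loopless].
pose y1 A := if K A then 0 else y A.
case: (pickP (fun A => y1 A != 0)) => [A0|y10]; last first.
  have [|z sz yz] := ac y _ dy; last by exists z => //; apply: supU.
  move=> A nz; have := y10 A; rewrite /y1; case: ifP => [/andP[le KA] _|_].
    by have [cA _ _] := sy _ nz.
  by rewrite (negbTE nz).
rewrite /y1; case: ifP => [|KA0 /sy[cA0 le0 EA0]]; first by rewrite eqxx.
have {KA0} nA0 : ~~ edge_mono E0 (b - mesym1 A0)%MM by move: KA0; rewrite /K le0 /= => ->.
have [x Exx ux] := edge_mono_square EA0 nA0.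
(* Two distinct square vertices are adjacent, and this edge would divide x^b / x^A0. *)
have uniq_x A x' : E x' x' -> (1 < (b - mesym1 A)%MM x')%N -> x' = x.
  move=> Ex' ux'; apply/eqP; apply: contraNT nA0 => ne; apply/loopless_monoP.
  exists x, x'; split; first by rewrite eq_sym.
  - by have := EC Exx Ex'; rewrite orbb.
  - exact: ltnW.
  move: ux'; rewrite !mnmBE !mnm_mesym1.
  by have := leq_b1 (x' \in A0); lia.
(* The doubled boolean asks for exponent at least 3 if [t = x] and at least 1 otherwise, so that x^2
   t divides x^b / x^A0. *)
have [t ut] : exists t, ((t == x).*2 < (b - mesym1 A0)%MM t)%N.
  apply/existsP; apply: contraLR bl; rewrite negb_exists => /forallP h.
  have le : (b - mesym1 A0 <= U_(x) + U_(x))%MM.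
    apply/mnm_lepP => t; have := h t; rewrite -leqNgt mnmDE mnm1E addnn eq_sym.
    by [].
  have := congr1 mdeg (submK le); have := congr1 mdeg (submK le0).
  by rewrite !mdegD !mdeg1 mdeg_mesym1 cA0 -leqNgt; lia.
have nExt : t != x -> ~~ E x t.
  move=> tx; apply: contraNN nA0 => Ext; apply/loopless_monoP.
  exists x, t; rewrite eq_sym; split=> //; first exact: ltnW.
  exact: leq_ltn_trans ut.
pose w := kcone (V := k^o) t y1.
have sw : supported (edge_mono E) b l.+1 w.
  move=> A; rewrite /w /kcone; case: ifP => [tA|]; last by rewrite eqxx.
  rewrite [_ *: _]/(_ * _) mulf_eq0 negb_or => /andP[_].
  rewrite /y1; case: ifP => [|KB /sy[cB leB EB]]; first by rewrite eqxx.
  have [|x' Ex' ux'] := edge_mono_square EB; first by move: KB; rewrite /K leB => /= ->.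
  have e := uniq_x _ _ Ex' ux'; rewrite {x' Ex'}e in ux'.
  split; first by rewrite (cardsD1 t) tA cB.
    apply/mnm_lepP => i; rewrite (mesym1D1 tA) mnmDE mnm1E.
    have := mnm_lepP leB i; case: eqP => [<-|]; rewrite ?addn0 // mnm_mesym1 setD11 => _.
    by move: ut; rewrite mnmBE; clear; lia.
  apply: (edge_mono_loop Exx); move: ux' ut; rewrite !mnmBE !mnm_mesym1 in_setD1.
  by rewrite [x == t]eq_sym; case: eqP => [<-|_] //=; rewrite tA; clear; lia.
have dyw : sdiff (fun B => y B - sdiff w B) =1 (fun=> 0).
  by move=> A; rewrite sdiffB dy sdiff_sdiff subr0.
have syw : supported (edge_mono E0) b l (fun B => y B - sdiff w B).
  move=> A nz.
  have [cA le EA] : [/\ #|A| = l, (mesym1 A <= b)%MM & edge_mono E (b - mesym1 A)%MM].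
    have [y0|/sy //] := eqVneq (y A) 0.
    apply: (supported_sdiff (@edge_mono_up E) sw); move: nz.
    by rewrite y0 sub0r oppr_eq0.
  split=> //; apply: contraNT nz => nE0.
  have KA : K A = false by rewrite /K le (negbTE nE0).
  have [x' Ex' ux'] := edge_mono_square EA nE0.
  have e := uniq_x _ _ Ex' ux'; rewrite {x' Ex'}e in ux'.
  (* Outside [K] the chains [y] and [y1] agree, so the homotopy leaves only the cone over the
     boundary of [y1]. *)
  have -> : y A - sdiff w A = kcone (V := k^o) t (sdiff y1) A.
    have := kcone_homotopy (V := k^o) t y1 A; rewrite [X in _ = X]/y1 KA => <-.
    by rewrite addrAC subrr add0r.
  rewrite /kcone; case: ifP => // tA.
  set B := A :\ t.
  (* If [B] is outside [K], so is every larger set; hence [y1] has the same boundary at [B] as the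
     cycle [y]. *)
  suff KB : K B = false.
    rewrite (_ : sdiff y1 B = 0) ?scaler0 // -[RHS](dy B).
    apply: eq_bigr => i iB; rewrite /y1.
    by case: ifP => // /(K_sub B _ (subsetUr _ _)); rewrite KB.
  have leB : (mesym1 B <= b)%MM by apply: lepm_trans le; apply/mesym1S/subsetDl.
  rewrite /K leB; apply/negbTE; apply: contraNN nE0.
  have uB i : (b - mesym1 B)%MM i = ((b - mesym1 A)%MM i + (i == t))%N.
    rewrite !mnmBE !mnm_mesym1 in_setD1; case: eqP => [->|_] /=; last by rewrite addn0.
    by rewrite tA; have := mnm_lepP le t; rewrite mnm_mesym1 tA; clear; lia.
  case/loopless_monoP=> p [q [pq Epq up uq]].
  (* An edge avoiding [t] already divides x^b / x^A, so only edges through [t] remain. *)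
  wlog pt : p q pq Epq up uq / p = t.
    move=> W; case: (p =P t) => [pt|pt]; first exact: W pq Epq up uq pt.
    case: (q =P t) => [qt|qt]; first by apply: W uq up qt; rewrite 1?eq_sym 1?Esym.
    apply/loopless_monoP; exists p, q; split=> //.
      by move: up; rewrite uB; case: eqP pt => // _ _; rewrite addn0.
    by move: uq; rewrite uB; case: eqP qt => // _ _; rewrite addn0.
  rewrite {p up}pt in pq Epq *.
  have uqA : (0 < (b - mesym1 A)%MM q)%N by move: uq; rewrite uB eq_sym (negbTE pq) addn0.
  have [tx|tx] := eqVneq t x.
    by apply/loopless_monoP; exists t, q; split=> //; rewrite tx; apply: ltnW.
  have := EC Exx Epq; rewrite (negbTE (nExt tx)) /= => Exq.
  apply/loopless_monoP; exists x, q; split=> //; last exact: ltnW.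
  by apply: contraNneq (nExt tx) => ->; rewrite Esym.
have [z sz yz] := ac _ syw dyw.
exists (fun A => z A + w A) => A; last first.
  rewrite -[LHS](subrK (sdiff w A)) yz; apply/esym/eqP; rewrite -subr_eq; apply/eqP.
  rewrite -sdiffB; apply: eq_sdiff => B; exact: addrK.
have [w0|/sw //] := eqVneq (w A) 0.
by rewrite w0 addr0 => nz; exact: supU sz _ nz.
Qed.

End Squares.

(* If x^2 and yz lie in the ideal but xy and xz do not, then {x} is an isolated
   vertex of the upper Koszul complex in multidegree x^2yz, while {y} is another
   vertex, so this complex is disconnected. *)
Lemma acyclic_square_condition E : ssrbool.symmetric E ->
  (forall b, mdeg b = 4 -> acyclic k (edge_mono E) b 1) -> square_condition E.
Proof.
move=> Esym ac x y z Exx Eyz; apply: contraT; rewrite negb_or => /andP[nxy nxz].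
have xy : x != y by apply: contraNneq nxy => <-.
have xz : x != z by apply: contraNneq nxz => <-.
set b := (U_(x) + U_(x) + (U_(y) + U_(z)))%MM.
pose c A : k := (A == [set x])%:R - (A == [set y])%:R.
have bE i : b i = ((x == i).*2 + ((y == i) + (z == i)))%N.
  by rewrite /b !mnmDE !mnm1E addnn.
have b4 : mdeg b = 4 by rewrite !mdegD !mdeg1.
have [||w sw cw] := ac b b4 c.
- move=> A; rewrite /c; have [->|Ax] := eqVneq A [set x].
    rewrite cards1 mesym1_set1 => _; split=> //; first by rewrite lep1mP bE eqxx.
    apply/edge_monoP; exists y, z; split=> //; apply/mnm_lepP => i.
    by rewrite mnmBE bE mnmDE !mnm1E; clear; lia.
  have [->|Ay] := eqVneq A [set y]; last by rewrite subrr eqxx.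
  rewrite cards1 mesym1_set1 => _; split=> //; first by rewrite lep1mP bE eqxx; lia.
  apply: (edge_mono_loop Exx); rewrite mnmBE bE mnm1E eqxx [y == x]eq_sym.
  by rewrite (negbTE xy); lia.
- move=> A; have [->|] := set_0Vmem A.
    rewrite /sdiff /kdiff (bigD1 x) ?inE //= (bigD1 y) ?inE //= 1?eq_sym // big1.
      rewrite !setU0 /c !eqxx !(inj_eq set1_inj) [y == x]eq_sym (negbTE xy).
      by rewrite !ksgn0 !mulr1 !scale1r subr0 sub0r addr0 subrr.
    move=> i /andP[/andP[_ ix] iy].
    by rewrite setU0 /c !(inj_eq set1_inj) (negbTE ix) (negbTE iy) subrr scaler0.
  case=> a aA; apply: big1 => i iA.
  have c2 v : (i |: A == [set v]) = false.
    apply/negbTE/eqP => /(congr1 (fun B => #|B|)); rewrite cards1 cardsU1 iA.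
    by rewrite (cardsD1 a) aA.
  by rewrite /c !c2 subrr scaler0.
have : sdiff w [set x] != 0.
  by rewrite -cw /c eqxx (inj_eq set1_inj) (negbTE xy) subr0 oner_eq0.
case/sum_neq0 => i; rewrite in_set1 => ix.
rewrite [_ *: _]/(_ * _) mulf_eq0 negb_or => /andP[_ /sw[_]].
rewrite mesym1U ?in_set1 // mesym1_set1 => le.
(* A second vertex [i] of a face containing [x] is [y] or [z]; the quotient is then x v with [v] the
   other of the two, and no generator divides it. *)
have [v [vE xv nxv]] : exists v, [/\ (b - (U_(x) + U_(i)) = U_(x) + U_(v))%MM, x != v & ~~ E x v].
  have : (0 < b i)%N by have := mnm_lepP le i; rewrite mnmDE !mnm1E eqxx; clear; lia.
  rewrite bE [x == i]eq_sym (negbTE ix) /= add0n.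
  have [yi _|_ /=] := eqVneq y i.
    exists z; split=> //; apply/mnmP => a; rewrite mnmBE bE !mnmDE !mnm1E yi; clear; lia.
  case: eqP => // zi _; exists y; split=> //; apply/mnmP => a.
  by rewrite mnmBE bE !mnmDE !mnm1E zi; clear; lia.
rewrite vE => /edge_monoP[p [q [Epq /mnm_lepP pq]]].
have := pq p; have := pq q; rewrite !mnmDE !mnm1E !eqxx.
have [xp|] := eqVneq x p; have [xq|] := eqVneq x q; rewrite -?xp -?xq.
- by rewrite eqxx eq_sym (negbTE xv).
- move=> _; case: (v =P q) => [vq _ _|_].
    by move: Epq; rewrite -xp -vq (negbTE nxv).
  by case: (x == q).
- move=> _; case: (v =P p) => [vp _ _|_ _].
    by move: Epq; rewrite -xq -vp Esym (negbTE nxv).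
  by case: (x == p).
move=> _ _; case: (v =P q) => [vq|_]; last by case: (p == q).
case: (v =P p) => [vp|_]; last by case: (p == q); case: (q == p).
by rewrite -vp -vq eqxx.
Qed.

End EdgeIdeals.

(** * The ideals of the theorem *)

Section MonomialIdeals.
Variables (k : fieldType) (n : nat).
Local Notation S := {mpoly k[n]}.
Local Notation mon := 'X_{1..n}.
Implicit Types (f : S) (G : S -> Prop) (M : mon -> Prop) (u : mon).
Implicit Types (E : rel 'I_n) (i j : 'I_n) (A B : {set 'I_n}).

Lemma eq_ideal_gen G G' f : (forall g, G g <-> G' g) -> ideal_gen G f <-> ideal_gen G' f.
Proof. by move=> GG'; split=> -[s sG ->]; exists s => // p /sG/GG'. Qed.

Lemma ideal_gen_sum (T : eqType) G (s : seq T) (F : T -> S) :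
  (forall t, t \in s -> ideal_gen G (F t)) -> ideal_gen G (\sum_(t <- s) F t).
Proof.
elim: s => [|t s IH] sG; first by exists [::] => //; rewrite !big_nil.
rewrite big_cons; have [r rG ->] := sG t (mem_head _ _).
have [|r' r'G ->] := IH; first by move=> t' t's; apply: sG; rewrite in_cons t's orbT.
exists (r ++ r'); last by rewrite big_cat.
by move=> p; rewrite mem_cat => /orP[/rG|/r'G].
Qed.

Lemma ideal_gen_monoP M f :
  ideal_gen (fun g => exists2 u, M u & g = 'X_[u]) f <->
  forall u, f@_u != 0 -> exists2 c, M c & (c <= u)%MM.
Proof.
split=> [[s sM ->] u|fM].
  rewrite raddf_sum /=; have [/hasP[p /sM[c Mc pc]]|/hasPn h] :=
    boolP (has (fun p : S * S => (p.1 * p.2)@_u != 0) s).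
    rewrite pc mulrC mcoeffXM; case: ifP => [cu _ _|]; last by rewrite eqxx.
    by exists c.
  by rewrite big_seq big1 ?eqxx // => p /h; rewrite negbK => /eqP.
rewrite [f]mpolyE; apply: ideal_gen_sum => u; rewrite mcoeff_msupp => /fM[c Mc cu].
exists [:: (f@_u *: 'X_[u - c], 'X_[c])].
  by move=> p; rewrite inE => /eqP ->; exists c.
by rewrite big_seq1 /= -scalerAl -mpolyXD submK.
Qed.

Lemma mono_idealX P u : mono_ideal P ('X_[u] : S) <-> P u.
Proof.
split=> [|Pu c]; first by apply; rewrite mcoeffX eqxx oner_eq0.
by rewrite mcoeffX; case: (u =P c) => [<-|]; rewrite ?eqxx.
Qed.

Lemma edge_mono_mdeg E u : edge_mono E u -> (1 < mdeg u)%N.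
Proof.
by case/edge_monoP => i [j [_ le]]; rewrite -(submK le) !mdegD !mdeg1 addnC.
Qed.

(** Exponents of quadratic monomials are at most 2, which fixes the bound used in
    [mono_resolution]. *)
Lemma edge_mono_clip E u : edge_mono E (clip 2 u) = edge_mono E u.
Proof.
apply/idP/idP; first exact/edge_mono_up/clip_le.
case/edge_monoP => i [j [Eij le]]; apply/edge_monoP; exists i, j; split=> //.
apply/mnm_lepP => a; have := mnm_lepP le a; rewrite [clip _ _ _]mnmE leq_min => -> /=.
by rewrite mnmDE !mnm1E; case: eqP; case: eqP.
Qed.

(** Any resolution witnessing a vanishing Tor yields the vanishing of Koszul homology, hence of its
    multigraded pieces; conversely [mono_resolution] provides the witness. *)
Lemma N2_acyclic E (I : S -> Prop) p : (forall f, I f <-> mono_ideal (edge_mono E) f) ->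
  N2 I p <-> forall l b, (l < p)%N -> (l + 2 < mdeg b)%N -> acyclic k (edge_mono E) b l.
Proof.
move=> IE.
have E0 : ~~ edge_mono E 0%MM by apply/negP => /edge_mono_mdeg; rewrite mdeg0.
have I0 f : I f -> f@_0 = 0.
  by move/IE => h; apply/eqP; apply: contraNT E0 => /h.
have kI l (j : nat) : kvanish (fun=> 0%N) (fun v : 'rV_1 => I (v 0 0)) l j <->
    forall b, mdeg b = j -> acyclic k (edge_mono E) b l.
  rewrite -(kvanish_acyclic _ _ _ E0).
  split=> h c cc Zc cyc; have [A|e [ee Ze he]] := h c cc _ cyc.
  - exact/IE.
  - by exists e; split=> // A; apply/IE.
  - exact/IE.
  - by exists e; split=> // A; apply/IE.
split=> [[_ _ tor] l b lp bl|ac].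
  have [F HF] := tor l lp _ bl.
  have vI := proj2 (kvanish_homologyk F I0 l (mdeg b)) HF.
  exact: (proj1 (kI l (mdeg b)) vI b).
split.
- exists (fun g => exists2 u, edge_mono E u & g = 'X_[u]).
    by move=> _ [u _ ->]; exists (mdeg u); rewrite dhomogX.
  move=> f; rewrite IE ideal_gen_monoP; split=> h u /h.
    by move=> Eu; exists u => //; apply: lepm_refl.
  by case=> c Ec cu; apply: edge_mono_up Ec.
- move=> f d d1 /dhomogP fd /IE fE; apply/mpolyP => u; rewrite mcoeff0.
  apply/eqP; apply: contraT => fu; have := edge_mono_mdeg (fE _ fu).
  by rewrite (fd u) ?mcoeff_msupp // ltnNge d1.
move=> l lp j jl.
have [F] := mono_resolution (@edge_mono_up n E) (edge_mono_clip E) IE.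
exists F; apply/(kvanish_homologyk F I0)/kI => b bj; apply: ac => //.
by rewrite bj.
Qed.

Lemma prod_mpolyX A : \prod_(i in A) 'X_i = 'X_[mesym1 A] :> S.
Proof.
rewrite mprodXE; congr 'X_[_]; apply/mnmP => j; rewrite mnm_mesym1 mnm_sumE.
rewrite big_mkcond (bigD1 j) //= mnm1E eqxx big1 => [|i ij]; first by case: (j \in A).
by rewrite mnm1E (negbTE ij) if_same.
Qed.

Lemma quadratic_edges (I : S -> Prop) : gen_by_quadratic_monomials I ->
  exists E, [/\ ssrbool.symmetric E, forall i j, E i j <-> I ('X_i * 'X_j)
    & forall f, I f <-> mono_ideal (edge_mono E) f].
Proof.
case=> M M2 IM.
have {}IM f : I f <-> forall u, f@_u != 0 -> exists2 c, M c & (c <= u)%MM.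
  by rewrite IM ideal_gen_monoP.
have IX u : I 'X_[u] <-> exists2 c, M c & (c <= u)%MM.
  rewrite IM; split=> [|[c Mc cu] u']; first by apply; rewrite mcoeffX eqxx oner_eq0.
  by rewrite mcoeffX; case: (u =P u') => [<- _|]; [exists c | rewrite eqxx].
(* Membership in [I] is only a proposition; excluded middle and finite choice turn it into a boolean
   graph. *)
have dec (ij : 'I_n * 'I_n) : exists e : bool, e <-> I ('X_(ij.1) * 'X_(ij.2)).
  by have [?|?] := classic (I ('X_(ij.1) * 'X_(ij.2))); [exists true | exists false].
have [e eP] := fin_all_exists dec; pose E i j := e (i, j).
have EP i j : E i j <-> I ('X_i * 'X_j) by exact: (eP (i, j)).
exists E; split=> // [i j|f].
  by apply/idP/idP => /EP; rewrite mulrC => /EP.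
rewrite IM; split=> h u /h => [[c Mc cu]|/edge_monoP[i [j [/EP]]]]; last first.
  by rewrite -mpolyXD => /IX[c Mc cij] iju; exists c => //; apply: lepm_trans iju.
have [i [j cij]] : exists i j, c = (U_(i) + U_(j))%MM.
  have c0 : c != 0%MM by rewrite -mdeg_eq0 (M2 _ Mc).
  have [i ci] : exists i, (U_(i) <= c)%MM.
    apply/existsP; apply: contraNT c0; rewrite negb_exists => /forallP h0.
    by apply/eqP/mnmP => i; have := h0 i; rewrite lep1mP negbK mnm0E => /eqP.
  have /eqP : mdeg (c - U_(i)) = 1%N.
    by have := congr1 mdeg (submK ci); rewrite mdegD mdeg1 (M2 _ Mc) addn1 => -[].
  by rewrite mdeg_eq1 => /existsP[j /eqP cj]; exists j, i; rewrite -cj submK.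
apply/edge_monoP; exists i, j; rewrite -cij; split=> //.
by apply/EP; rewrite -mpolyXD -cij; apply/IX; exists c => //; apply: lepm_refl.
Qed.

Lemma squarefree_partP (I : S -> Prop) E : (forall i j, E i j <-> I ('X_i * 'X_j)) ->
  forall f, squarefree_part I f <-> mono_ideal (edge_mono (loopless E)) f.
Proof.
move=> EP f; pose M u := exists i j, loopless E i j /\ u = (U_(i) + U_(j))%MM.
transitivity (ideal_gen (fun g : S => exists2 u, M u & g = 'X_[u]) f).
  apply: eq_ideal_gen => g; split=> [[i [j [ij -> /EP Eij]]]|[u [i [j [/andP[ij /EP Iij] ->]] ->]]].
    by exists (U_(i) + U_(j))%MM; rewrite ?mpolyXD //; exists i, j; rewrite /loopless ij.
  by exists i, j; rewrite -mpolyXD in Iij *; split=> //; rewrite mpolyXD.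
rewrite ideal_gen_monoP; split=> h u /h => [[_ [i [j [Eij ->]] le]]|/edge_monoP[i [j [Eij le]]]].
  by apply/edge_monoP; exists i, j.
by exists (U_(i) + U_(j))%MM => //; exists i, j.
Qed.

Lemma mesym1_le A u : (mesym1 A <= u)%MM -> forall i, i \in A -> (0 < u i)%N.
Proof. by move/mnm_lepP => h i iA; have := h i; rewrite mnm_mesym1 iA. Qed.

(** The Stanley-Reisner ideal determines the complex: x^A lies in it exactly when [A] is a nonface,
    that is, when [A] contains an edge. *)
Lemma flag_complex E (D : {set {set 'I_n}}) : simplicial_complex D ->
  (forall f, stanley_reisner k D f <-> mono_ideal (edge_mono (loopless E)) f) ->
  forall A, A \in D <-> {in A &, forall i j, ~~ loopless E i j}.
Proof.
move=> [Dsub _] DE A.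
have SR f : stanley_reisner k D f <->
    forall u, f@_u != 0 -> exists2 c, (exists2 B, B \notin D & c = mesym1 B) & (c <= u)%MM.
  rewrite -ideal_gen_monoP; apply: eq_ideal_gen => g; split.
    by case=> B BD ->; exists (mesym1 B); [exists B | exact: prod_mpolyX].
  by case=> _ [B BD ->] ->; exists B => //; rewrite prod_mpolyX.
split=> [AD i j iA jA|AE].
  apply/negP => Eij; have : stanley_reisner k D 'X_[U_(i) + U_(j)].
    by apply/DE/mono_idealX/edge_monoP; exists i, j; split=> //; apply: lepm_refl.
  move/SR/(_ (U_(i) + U_(j))%MM); rewrite mcoeffX eqxx oner_eq0 => -[//|_ [B BD ->] le].
  case/negP: BD; apply: Dsub AD; apply/subsetP => a /(mesym1_le le).
  by rewrite mnmDE !mnm1E; case: eqP => [<-|_] //; case: eqP => [<-|].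
apply: contraT => AD; have : stanley_reisner k D 'X_[mesym1 A].
  by rewrite -prod_mpolyX; exists [:: (1, \prod_(i in A) 'X_i)];
    [move=> p; rewrite inE => /eqP ->; exists A | rewrite big_seq1 mul1r].
move/DE/mono_idealX/loopless_monoP => [i [j [ij Eij]]].
rewrite !mnm_mesym1 !lt0b => iA jA.
by have := AE i j iA jA; rewrite /loopless ij Eij.
Qed.

Lemma link_square_condition E (D : {set {set 'I_n}}) : ssrbool.symmetric E ->
  (forall A B, A \subset B -> B \in D -> A \in D) ->
  (forall A, A \in D <-> {in A &, forall i j, ~~ loopless E i j}) ->
  square_condition E <-> forall x, E x x ->
    is_simplex (link x D) /\ forall y, E y y -> [set y] \notin link x D.
Proof.
move=> Esym Dsub DE.
have edge x y : x != y -> ([set x; y] \in D) = ~~ E x y.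
  move=> xy; apply/idP/idP => [/DE/(_ x y)|nE].
    by rewrite !in_set2 !eqxx orbT /loopless xy; apply.
  apply/DE => i j /set2P[]-> /set2P[]-> ; rewrite /loopless ?eqxx //= ?xy //.
  by rewrite Esym (negbTE nE) andbF.
have link1 x y : x != y -> ([set y] \in link x D) = ~~ E x y.
  move=> xy; rewrite inE in_set1 xy -(edge x y xy) andbC /= andb_idr // => xyD.
  by apply: Dsub xyD; rewrite subsetUr.
split=> [EC x Exx|h x y z Exx Eyz].
  split=> [|y Eyy]; last first.
    have [->|xy] := eqVneq y x; first by rewrite inE in_set1 eqxx andbF.
    by rewrite link1 1?eq_sym // negbK; have := EC x y y Exx Eyy; rewrite orbb.
  (* The simplex is spanned by the non-neighbours of [x]; [EC] excludes edges among them. *)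
  exists [set v | (v != x) && ~~ E x v]; apply/setP => A; rewrite powersetE inE.
  apply/idP/subsetP => [/and3P[_ xA /DE xAD] v vA|AV].
    rewrite inE; have vx : v != x by apply: contraNneq xA => <-.
    have := xAD x v; rewrite !in_setU1 eqxx vA orbT /loopless [x == v]eq_sym vx /=.
    by apply.
  have xA : x \notin A by apply/negP => /AV; rewrite inE eqxx.
  have xAD : x |: A \in D.
    apply/DE => i j /setU1P[->|iA] /setU1P[->|jA]; rewrite /loopless ?eqxx //.
    - by have := AV j jA; rewrite inE => /andP[_ /negbTE ->]; rewrite andbF.
    - by have := AV i iA; rewrite inE Esym => /andP[_ /negbTE ->]; rewrite andbF.
    apply/nandP; right; apply/negP => Eij; have := EC x i j Exx Eij.
    have := AV i iA; have := AV j jA; rewrite !inE => /andP[_ /negbTE ->].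
    by case/andP=> _ /negbTE ->.
  by rewrite xA xAD !andbT; apply: Dsub xAD; apply: subsetUr.
have [[V VE] sq] := h x Exx; apply: contraT; rewrite negb_or => /andP[nxy nxz].
have xy : x != y by apply: contraNneq nxy => <-.
have xz : x != z by apply: contraNneq nxz => <-.
(* For [y = z] the link would contain a square vertex; otherwise, being a simplex, it would contain
   the nonface [[set y; z]]. *)
have [yz|yz] := eqVneq y z.
  by move: Eyz; rewrite -yz => /sq; rewrite link1 // nxy.
have := link1 x y xy; have := link1 x z xz; rewrite nxy nxz VE !powersetE !sub1set => zV yV.
have : [set y; z] \in link x D by rewrite VE powersetE subUset !sub1set yV zV.
by rewrite inE => /andP[]; rewrite edge // Eyz.
Qed.

End MonomialIdeals.

(** * The theorem, read off from acyclicity of upper Koszul complexes *)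

Theorem proposition2p4 (k : closedFieldType) (r : nat)
    (I : {mpoly k[r.+1]} -> Prop) (Delta : {set {set 'I_r.+1}}) :
  gen_by_quadratic_monomials I ->
  simplicial_complex Delta ->
  same_ideal (stanley_reisner k Delta) (squarefree_part I) ->
  same_ideal I (ideal_add (stanley_reisner k Delta) (square_part I)) ->
  (N2 I 2 <->
     N2 (stanley_reisner k Delta) 2 /\
     forall x : 'I_r.+1, square_vertex I x ->
       is_simplex (link x Delta) /\
       forall y : 'I_r.+1, square_vertex I y -> [set y] \notin link x Delta) /\
  (N2 I 2 -> forall p : nat, (3 <= p)%N ->
     (N2 I p <-> N2 (stanley_reisner k Delta) p)).
Proof.
move=> /quadratic_edges[E [Esym EP IE]] Dcx SRI _.
have SRE f : stanley_reisner k Delta f <-> mono_ideal (edge_mono (loopless E)) f.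
  by rewrite SRI (squarefree_partP EP).
have N2I p := N2_acyclic p IE; have N2SR p := N2_acyclic p SRE.
have sqE x : square_vertex I x <-> E x x by rewrite EP /square_vertex expr2.
have linkE : square_condition E <-> forall x, square_vertex I x ->
    is_simplex (link x Delta) /\ forall y, square_vertex I y -> [set y] \notin link x Delta.
  rewrite (link_square_condition Esym Dcx.1 (flag_complex Dcx SRE)).
  by split=> h x /sqE/h[? hy]; split=> // y /sqE/hy.
have I_SR p : N2 I p -> N2 (stanley_reisner k Delta) p.
  by move=> /N2I ac; apply/N2SR => l b lp bl; apply/acyclic_loopless/ac.
have SR_I p : square_condition E -> N2 (stanley_reisner k Delta) p -> N2 I p.
  by move=> EC /N2SR ac; apply/N2I => l b lp bl; apply/acyclic_squares/ac.
have N2_sq : N2 I 2 -> square_condition E.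
  (* The obstruction sits in degree 4, that of x^2 y z, which exceeds [l + 2] for [l = 1]. *)
  by move=> /N2I ac; apply: (acyclic_square_condition Esym) => b b4; apply: ac; rewrite ?b4.
split=> [|/N2_sq EC p _]; last by split; [exact: I_SR | exact: SR_I].
rewrite -linkE; split=> [h|[h EC]]; last exact: SR_I.
by split; [exact: I_SR | exact: N2_sq].
Qed.
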